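(* Let $b\ge3$, $D\subset\{0,\dots,b-1\}$ with $0\in D$ and $2\le|D|<b$, and list $\mathcal C=\mathcal C_{b,D}$ increasingly as $k_1<k_2<\cdots$. Let $P(x,y)=\sum_{i,j}c_{ij}x^iy^j$ be a real polynomial such that $c_{ij}$ is irrational for some $(i,j)\neq(0,0)$. Then $$\lim_{N-M\to\infty}\frac1{N-M}\sum_{M<n\le N}e\big(P(k_n,s_b(k_n))\big)=0$$ (uniformly in $M$: for every $\eta>0$ there is $L$ such that the average has modulus $<\eta$ whenever $0\le M<N$, $N-M\ge L$). Consequently, for every polynomial map $p=(p_1,p_2):\mathbb R^2\to\mathbb R^2$ such that $m\cdot p$ has an irrational non-constant coefficient for every $m\in\mathbb Z^2\setminus\{0\}$, the sequence $p(k_n,s_b(k_n))$ is uniformly distributed modulo $1$ in $[0,1)^2$, and the averages of $e(m\cdot p(k_n,s_b(k_n)))$ over $M<n\le N$ tend to $0$ as $N-M\to\infty$ for every $m\in\mathbb Z^2\setminus\{0\}$.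
   Context: $\mathcal C_{b,D}=\{\sum_{j=0}^{k} d_j b^j : k\in\mathbb N_0,\ d_j\in D\}$; $s_b(k)$ is the base-$b$ sum of digits; $e(x)=e^{2\pi ix}$. A sequence $(x_n)\subset\mathbb R^2$ is uniformly distributed mod 1 if the fractional parts satisfy $\frac1N\#\{n\le N:\{x_n\}\in(a,b)\times(c,d)\}\to(b-a)(d-c)$ for all subrectangles of $[0,1)^2$. *)

(* Defs.v *)
From Stdlib Require Import Reals Lra Lia Arith List QArith.
Open Scope R_scope.

Fixpoint nsum (f : nat -> nat) (K : nat) : nat :=
  match K with
  | O => f O
  | S K' => (nsum f K' + f K)%nat
  end.

Definition inC (b : nat) (D : list nat) (k : nat) : Prop :=
  exists (K : nat) (d : nat -> nat),
    (forall j, (j <= K)%nat -> In (d j) D) /\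
    k = nsum (fun j => (d j * b ^ j)%nat) K.

Definition digit (b k j : nat) : nat := ((k / b ^ j) mod b)%nat.

(* s_b(k): base-b sum of digits (digits beyond position k vanish for b >= 2) *)
Definition sdig (b k : nat) : nat := nsum (fun j => digit b k j) k.

Definition e_re (x : R) : R := cos (2 * PI * x).
Definition e_im (x : R) : R := sin (2 * PI * x).

Fixpoint rsum_from (f : nat -> R) (start len : nat) : R :=
  match len with
  | O => 0
  | S l => rsum_from f start l + f (start + S l)%nat
  end.
Definition rsum (f : nat -> R) (M N : nat) : R := rsum_from f M (N - M).

Definition exp_avg_mod (g : nat -> R) (M N : nat) : R :=
  let L := INR (N - M) in
  sqrt (Rsqr (rsum (fun n => e_re (g n)) M N / L) +
        Rsqr (rsum (fun n => e_im (g n)) M N / L)).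

Definition avg_tends_to_0 (g : nat -> R) : Prop :=
  forall eta : R, eta > 0 -> exists L : nat,
    forall M N : nat, (M < N)%nat -> (L <= N - M)%nat -> exp_avg_mod g M N < eta.

Definition poly2 (d : nat) (c : nat -> nat -> R) (x y : R) : R :=
  sum_f_R0 (fun i => sum_f_R0 (fun j => c i j * x ^ i * y ^ j) d) d.

Definition irrational (x : R) : Prop := ~ exists q : Q, x = Q2R q.

Definition has_irrational_nonconst_coef (d : nat) (c : nat -> nat -> R) : Prop :=
  exists i j : nat, (i <= d)%nat /\ (j <= d)%nat /\ ~ (i = 0%nat /\ j = 0%nat) /\
    irrational (c i j).

Fixpoint count_upto (P : nat -> bool) (N : nat) : nat :=
  match N with
  | O => O
  | S N' => (count_upto P N' + (if P N then 1 else 0))%nat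
  end.

Definition in_open_box (a b c d : R) (x y : R) : bool :=
  if Rlt_dec a x then if Rlt_dec x b then if Rlt_dec c y then
     if Rlt_dec y d then true else false else false else false else false.

Definition unif_distr_mod1_2 (x y : nat -> R) : Prop :=
  forall a b c d : R, 0 <= a -> a < b -> b <= 1 -> 0 <= c -> c < d -> d <= 1 ->
    Un_cv (fun N => INR (count_upto
              (fun n => in_open_box a b c d (frac_part (x n)) (frac_part (y n))) N)
            / INR N)
          ((b - a) * (d - c)).

(* Main.v *)
(** Writing the index of [k_n] in base [|D|] and replacing the digits of the index by those of [D]
    gives [k_n], so that blocks of indices of length [|D|^K] are digit blocks, over which
    [(k_n, s_b(k_n))] runs through a fixed set translated by a vector depending on the block.
    Splitting the digits of such a block into low and high ones and applying Cauchy's inequality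
    replaces [P] by the differences [P(z + w) - P(z + w')], of smaller degree and with translations
    absorbed, whence estimates uniform in the block. If the top degree part of [P] has an irrational
    coefficient, the differences losing this property have all their steps [w - w'] on one line, and
    few pairs of low digit blocks are on that line, by the linear case. In the linear case
    [alpha * k + beta * s] the sum over a block is a product over digit positions [j], and the
    factors stay away from 1 for infinitely many [j] because [x -> b * x] expands near the integers.
    Monomials with rational coefficients above the degree of the irrational ones only contribute
    periodic factors, hence finite combinations of characters of finite order.

    Uniform distribution follows by Weyl's criterion. A lower bound for the density of a box comes
    from products of sums of Fejer kernels; the complement of a box being made of four boxes, up to
    a set of lines, this also yields the upper bound. *)
Require Import Defs.
From Stdlib Require Import Reals List QArith.
From Stdlib Require Import Lra Lia Psatz Classical Qreals ZArith Arith.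
From Coquelicot Require Import Complex.
Open Scope R_scope.

(** * Finite sums and characters *)

Fixpoint rs (f : nat -> R) (n : nat) : R :=
  match n with O => 0 | S m => rs f m + f m end.

Fixpoint csum (f : nat -> Complex.C) (n : nat) : Complex.C :=
  match n with O => RtoC 0 | S m => Cplus (csum f m) (f m) end.

Lemma rs_ext f g n : (forall i, (i < n)%nat -> f i = g i) -> rs f n = rs g n.
Proof.
  induction n as [|n IH]; intros H; simpl; [reflexivity|].
  rewrite IH, H; auto with arith.
Qed.

Lemma rs_le f g n : (forall i, (i < n)%nat -> f i <= g i) -> rs f n <= rs g n.
Proof.
  induction n as [|n IH]; intros H; simpl; [lra|].
  apply Rplus_le_compat; auto with arith.
Qed.

Lemma rs_plus f g n : rs (fun i => f i + g i) n = rs f n + rs g n.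
Proof. induction n as [|n IH]; simpl; [lra|rewrite IH; ring]. Qed.

Lemma rs_scal c f n : rs (fun i => c * f i) n = c * rs f n.
Proof. induction n as [|n IH]; simpl; [lra|rewrite IH; ring]. Qed.

Lemma rs_const c n : rs (fun _ => c) n = INR n * c.
Proof. induction n as [|n IH]; [simpl; lra|]. rewrite S_INR. simpl rs. rewrite IH. ring. Qed.

Lemma rs_ge0 f n : (forall i, (i < n)%nat -> 0 <= f i) -> 0 <= rs f n.
Proof.
  intros H. replace 0 with (rs (fun _ => 0) n) by (rewrite rs_const; ring).
  now apply rs_le.
Qed.

Lemma rs_le_const f c n : (forall i, (i < n)%nat -> f i <= c) -> rs f n <= INR n * c.
Proof. intros H. rewrite <- rs_const. now apply rs_le. Qed.

Lemma rs_exch (f : nat -> nat -> R) m n :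
  rs (fun i => rs (fun j => f i j) n) m = rs (fun j => rs (fun i => f i j) m) n.
Proof.
  induction m as [|m IH]; simpl; [rewrite rs_const; ring|].
  rewrite IH, <- rs_plus. reflexivity.
Qed.

Lemma rs_head f n : rs f (S n) = f 0%nat + rs (fun i => f (S i)) n.
Proof.
  induction n as [|n IH]; [simpl; ring|].
  change (rs f (S n) + f (S n) = f 0%nat + (rs (fun i => f (S i)) n + f (S n))).
  rewrite IH. ring.
Qed.

Lemma rs_add f m n : rs f (m + n) = rs f m + rs (fun i => f (m + i)%nat) n.
Proof.
  induction n as [|n IH]; [rewrite Nat.add_0_r; simpl; ring|].
  rewrite Nat.add_succ_r. simpl. rewrite IH. ring.
Qed.

Lemma rs_vanish f m n : (m <= n)%nat -> (forall i, (m <= i)%nat -> (i < n)%nat -> f i = 0) ->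
  rs f n = rs f m.
Proof.
  intros Hmn H. replace n with (m + (n - m))%nat by lia. rewrite rs_add.
  rewrite (rs_ext (fun i => f (m + i)%nat) (fun _ => 0)), rs_const; [ring|]. intros; apply H; lia.
Qed.

Lemma rs_single f j n : (j < n)%nat -> (forall i, (i < n)%nat -> i <> j -> f i = 0) -> rs f n = f j.
Proof.
  intros Hj H. rewrite (rs_vanish f (S j) n) by (try lia; intros; apply H; lia).
  simpl. rewrite (rs_vanish f 0 j) by (try lia; intros; apply H; lia). simpl. ring.
Qed.

Local Open Scope C_scope.

Lemma csum_ext f g n : (forall i, (i < n)%nat -> f i = g i) -> csum f n = csum g n.
Proof.
  induction n as [|n IH]; intros H; simpl; [reflexivity|].
  rewrite IH, H; auto with arith.
Qed.

Lemma csum_plus f g n : csum (fun i => f i + g i) n = csum f n + csum g n.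
Proof. induction n as [|n IH]; simpl; [ring|rewrite IH; ring]. Qed.

Lemma csum_scal c f n : csum (fun i => c * f i) n = c * csum f n.
Proof. induction n as [|n IH]; simpl; [ring|rewrite IH; ring]. Qed.

Lemma csum_scal_r c f n : csum (fun i => f i * c) n = csum f n * c.
Proof. induction n as [|n IH]; simpl; [ring|rewrite IH; ring]. Qed.

Lemma csum_const c n : csum (fun _ => c) n = RtoC (INR n) * c.
Proof.
  induction n as [|n IH]; [simpl; ring|]. rewrite S_INR, RtoC_plus. simpl csum. rewrite IH. ring.
Qed.

Lemma csum_exch (f : nat -> nat -> Complex.C) m n :
  csum (fun i => csum (fun j => f i j) n) m = csum (fun j => csum (fun i => f i j) m) n.
Proof.
  induction m as [|m IH]; simpl.
  - rewrite csum_const. ring.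
  - rewrite IH, <- csum_plus. reflexivity.
Qed.

Lemma csum_add f m n : csum f (m + n) = csum f m + csum (fun i => f (m + i)%nat) n.
Proof.
  induction n as [|n IH]; [rewrite Nat.add_0_r; simpl; ring|].
  rewrite Nat.add_succ_r. simpl. rewrite IH. ring.
Qed.

Lemma csum_mul f q n : csum f (q * n) = csum (fun i => csum (fun r => f (i * n + r)%nat) n) q.
Proof.
  induction q as [|q IH]; [reflexivity|].
  replace (S q * n)%nat with (q * n + n)%nat by lia. rewrite csum_add, IH. reflexivity.
Qed.

Lemma csum_conj f n : Cconj (csum f n) = csum (fun i => Cconj (f i)) n.
Proof.
  induction n as [|n IH]; simpl.
  - unfold Cconj, RtoC; simpl. now rewrite Ropp_0.
  - now rewrite Cplus_conj, IH.
Qed.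

Lemma csum_RtoC f n : csum (fun i => RtoC (f i)) n = RtoC (rs f n).
Proof. induction n as [|n IH]; simpl; [reflexivity|]. now rewrite IH, RtoC_plus. Qed.

Lemma csum_single (f : nat -> Complex.C) j n : (j < n)%nat -> (forall i, (i < n)%nat -> i <> j -> f i = 0) ->
  csum f n = f j.
Proof.
  intros Hj H. replace n with (j + (1 + (n - S j)))%nat by lia.
  rewrite csum_add, csum_add. simpl csum at 2. rewrite Nat.add_0_r.
  rewrite (csum_ext _ (fun _ => RtoC 0) j), (csum_ext _ (fun _ => RtoC 0) (n - S j)), !csum_const.
  - ring.
  - intros; apply H; lia.
  - intros; apply H; lia.
Qed.

Lemma Re_csum f n : Re (csum f n) = rs (fun i => Re (f i)) n.
Proof. induction n as [|n IH]; simpl; [reflexivity|]. now rewrite <- IH. Qed.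

Lemma Im_csum f n : Im (csum f n) = rs (fun i => Im (f i)) n.
Proof. induction n as [|n IH]; simpl; [reflexivity|]. now rewrite <- IH. Qed.

Lemma Cmod_csum f n : (Cmod (csum f n) <= rs (fun i => Cmod (f i)) n)%R.
Proof.
  induction n as [|n IH]; simpl; [rewrite Cmod_0; lra|].
  eapply Rle_trans; [apply Cmod_triangle|]. lra.
Qed.

Lemma Cmod_csum_le f c n : (forall i, (i < n)%nat -> (Cmod (f i) <= c)%R) ->
  (Cmod (csum f n) <= INR n * c)%R.
Proof. intros H. eapply Rle_trans; [apply Cmod_csum|]. now apply rs_le_const. Qed.

Lemma csum_mult f g m n : csum f m * csum g n = csum (fun i => csum (fun j => f i * g j) n) m.
Proof.
  rewrite <- csum_scal_r. apply csum_ext. intros. now rewrite csum_scal.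
Qed.

Lemma Cmod2_csum f n :
  RtoC (Cmod (csum f n) ^ 2) = csum (fun i => csum (fun j => f i * Cconj (f j)) n) n.
Proof. now rewrite Cmod2_conj, csum_conj, csum_mult. Qed.

(** With $s$ the sum of the $f_i$ and $Q$ that of their squares, the nonnegative sum of the
    $(Nf_i-s)^2$ equals $N(NQ-s^2)$. *)
Lemma rs_cauchy f n : (rs f n ^ 2 <= INR n * rs (fun i => f i ^ 2) n)%R.
Proof.
  destruct n as [|n]; [simpl; lra|].
  set (N := INR (S n)). assert (HN : (0 < N)%R) by apply lt_0_INR, Nat.lt_0_succ.
  set (s := rs f (S n)).
  assert (H : (0 <= rs (fun i => (N * f i - s) ^ 2) (S n))%R)
    by (apply rs_ge0; intros; apply pow2_ge_0).
  rewrite (rs_ext _ (fun i => N ^ 2 * f i ^ 2 + ((- 2 * N * s) * f i + s ^ 2))%R) in H by (intros; ring).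
  rewrite !rs_plus, !rs_scal, rs_const in H. fold N s in H.
  apply Rmult_le_reg_l with N; [exact HN|]. nra.
Qed.

Lemma Cmod_csum_cauchy f n : (Cmod (csum f n) ^ 2 <= INR n * rs (fun i => Cmod (f i) ^ 2) n)%R.
Proof.
  eapply Rle_trans; [|apply rs_cauchy].
  apply pow_incr. split; [apply Cmod_ge_0|apply Cmod_csum].
Qed.

(** Expand the squares, sum over $y$ first, then apply the triangle inequality to the pairs
    $(x,x')$. Used twice: for the second moment in [concentration] and for the differencing in
    [cancelling_step]. *)
Lemma rs_Cmod2_le (a : nat -> nat -> Complex.C) m n :
  (rs (fun y => Cmod (csum (fun x => a x y) m) ^ 2) n <=
   rs (fun x => rs (fun x' => Cmod (csum (fun y => (a x y * Cconj (a x' y))%C) n)) m) m)%R.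
Proof.
  set (S0 := rs _ n).
  assert (E : RtoC S0 = csum (fun x => csum (fun x' => csum (fun y => a x y * Cconj (a x' y)) n) m) m).
  { unfold S0. rewrite <- csum_RtoC. rewrite (csum_ext _ _ n (fun y _ => Cmod2_csum (fun x => a x y) m)).
    rewrite csum_exch. apply csum_ext. intros x _. now rewrite csum_exch. }
  assert (H0 : (0 <= S0)%R) by (apply rs_ge0; intros; apply pow2_ge_0).
  rewrite <- (Rabs_pos_eq S0 H0), <- Cmod_R, E.
  eapply Rle_trans; [apply Cmod_csum|]. apply rs_le. intros. apply Cmod_csum.
Qed.

(** * The character $e(x)$ and roots of unity *)

Definition ee (x : R) : Complex.C := (e_re x, e_im x).

Lemma ee_0 : ee 0 = 1.
Proof. unfold ee, e_re, e_im. rewrite Rmult_0_r, cos_0, sin_0. reflexivity. Qed.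

Lemma ee_plus x y : ee (x + y) = ee x * ee y.
Proof.
  unfold ee, e_re, e_im, Cmult. simpl. rewrite Rmult_plus_distr_l, cos_plus, sin_plus.
  f_equal; ring.
Qed.

Lemma Cmod_ee x : Cmod (ee x) = 1%R.
Proof.
  unfold Cmod, ee, e_re, e_im; simpl. rewrite !Rmult_1_r.
  rewrite <- sqrt_1. f_equal. rewrite Rplus_comm. apply (sin2_cos2 (2 * PI * x)).
Qed.

Lemma ee_opp x : ee (- x) = Cconj (ee x).
Proof.
  unfold ee, e_re, e_im, Cconj; simpl.
  replace (2 * PI * - x)%R with (- (2 * PI * x))%R by ring. now rewrite cos_neg, sin_neg.
Qed.

Lemma ee_minus x y : ee (x - y) = ee x * Cconj (ee y).
Proof. unfold Rminus. now rewrite ee_plus, ee_opp. Qed.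

Lemma ee_INR n x : ee (INR n * x) = (ee x) ^ n.
Proof.
  induction n as [|n IH]; [simpl; rewrite Rmult_0_l; apply ee_0|].
  rewrite S_INR, Rmult_plus_distr_r, Rmult_1_l, ee_plus, IH. simpl. ring.
Qed.

Lemma ee_IZR (z : Z) : ee (IZR z) = 1.
Proof.
  assert (H : forall n, ee (INR n) = 1).
  { intros n. unfold ee, e_re, e_im. replace (2 * PI * INR n)%R with (0 + 2 * INR n * PI)%R by ring.
    rewrite cos_period, sin_period, cos_0, sin_0. reflexivity. }
  destruct (Z_le_gt_dec 0 z).
  - rewrite <- (Z2Nat.id z) by lia. rewrite <- INR_IZR_INZ. apply H.
  - replace z with (- Z.of_nat (Z.to_nat (- z)))%Z by lia.
    rewrite opp_IZR, ee_opp, <- INR_IZR_INZ, H. unfold Cconj, RtoC; simpl. now rewrite Ropp_0.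
Qed.

Lemma ee_add_IZR x (z : Z) : ee (x + IZR z) = ee x.
Proof. rewrite ee_plus, ee_IZR. ring. Qed.

Lemma ee_eq_1 x : ee x = 1 -> exists z : Z, x = IZR z.
Proof.
  intros H. assert (Hc : cos (2 * PI * x) = 1%R) by exact (f_equal fst H).
  (* From $\cos 2a = 1-2\sin^2 a$ with $a=\pi x$. *)
  assert (Hs : sin (PI * x) = 0%R).
  { replace (2 * PI * x)%R with (2 * (PI * x))%R in Hc by ring. rewrite cos_2a_sin in Hc. nra. }
  destruct (sin_eq_0_0 _ Hs) as [z Hz]. exists z.
  apply Rmult_eq_reg_r with PI; [lra|]. apply Rgt_not_eq, PI_RGT_0.
Qed.

Lemma Cmod_ee_pow x n : Cmod (ee x ^ n) = 1%R.
Proof. now rewrite Cmod_pow, Cmod_ee, pow1. Qed.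

Lemma geom_telescope (z : Complex.C) n : csum (fun i => z ^ i) n * (z - 1) = z ^ n - 1.
Proof. induction n as [|n IH]; simpl; [ring|]. rewrite Cmult_plus_distr_r, IH. ring. Qed.

Lemma Cmod_pow_sub_1 (z : Complex.C) n : Cmod z = 1%R -> (Cmod (z ^ n - 1) <= INR n * Cmod (z - 1))%R.
Proof.
  intros Hz. rewrite <- geom_telescope, Cmod_mult.
  apply Rmult_le_compat_r; [apply Cmod_ge_0|].
  rewrite <- (Rmult_1_r (INR n)). apply Cmod_csum_le. intros. rewrite Cmod_pow, Hz, pow1. lra.
Qed.

(** A geometric sum with ratio $w=e(z/q)$, where $w^q=1$, and $w=1$ exactly when $q$ divides $z$. *)
Lemma csum_roots_of_unity (q : nat) (z : Z) : (0 < q)%nat ->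
  csum (fun u => ee (INR u * (IZR z / INR q))) q =
  if Z.eq_dec (z mod Z.of_nat q) 0 then RtoC (INR q) else 0.
Proof.
  intros Hq. assert (Hq' : (INR q <> 0)%R) by (apply not_0_INR; lia).
  destruct (Z.eq_dec _ _) as [E|E].
  - apply Z.mod_divide in E; [|lia]. destruct E as [w ->].
    rewrite (csum_ext _ (fun _ => RtoC 1)), csum_const; [ring|].
    intros i _. rewrite mult_IZR, <- INR_IZR_INZ.
    replace (INR i * (IZR w * INR q / INR q))%R with (IZR (Z.of_nat i * w)).
    + apply ee_IZR.
    + rewrite mult_IZR, <- INR_IZR_INZ. field; assumption.
  - rewrite (csum_ext _ (fun u => ee (IZR z / INR q) ^ u)) by (intros; apply ee_INR).
    set (w := ee _). assert (Hw : w - 1 <> 0).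
    { intros H. assert (H1 : w = 1) by (rewrite <- (Cplus_0_l 1), <- H; ring).
      destruct (ee_eq_1 _ H1) as [v Hv]. apply E. apply Z.mod_divide; [lia|].
      exists v. apply eq_IZR. rewrite mult_IZR, <- INR_IZR_INZ, <- Hv. field; assumption. }
    assert (Ht := geom_telescope w q).
    replace (w ^ q - 1) with (RtoC 0) in Ht.
    + rewrite <- (Cmult_1_r (csum _ _)). rewrite <- (Cinv_r _ Hw), Cmult_assoc, Ht. ring.
    + unfold w. rewrite <- ee_INR. replace (INR q * (IZR z / INR q))%R with (IZR z) by (field; assumption).
      rewrite ee_IZR. ring.
Qed.

Local Close Scope C_scope.

(** * Digits *)

Definition rational (x : R) : Prop := exists q : Q, x = Q2R q.

Lemma rational_IZR z : rational (IZR z).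
Proof. exists (inject_Z z). unfold Q2R, inject_Z; simpl. field. Qed.

Lemma rational_plus x y : rational x -> rational y -> rational (x + y).
Proof. intros [p ->] [q ->]. exists (p + q)%Q. now rewrite Q2R_plus. Qed.

Lemma rational_mult x y : rational x -> rational y -> rational (x * y).
Proof. intros [p ->] [q ->]. exists (p * q)%Q. now rewrite Q2R_mult. Qed.

Lemma rational_minus x y : rational x -> rational y -> rational (x - y).
Proof. intros [p ->] [q ->]. exists (p - q)%Q. now rewrite Q2R_minus. Qed.

Lemma rational_IZR_mult_rev z x : z <> 0%Z -> rational (IZR z * x) -> rational x.
Proof.
  intros Hz [q Hq]. exists (q / inject_Z z)%Q.
  assert (Hz' : ~ (inject_Z z == 0)%Q) by (intros H; apply Hz; now apply inject_Z_injective).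
  rewrite Q2R_div by assumption. rewrite <- Hq. unfold Q2R, inject_Z; simpl.
  field. now apply not_0_IZR.
Qed.

Lemma rational_fraction x : rational x -> exists (z : Z) (q : nat), (0 < q)%nat /\ x = IZR z / INR q.
Proof.
  intros [[z p] ->]. exists z, (Pos.to_nat p). split; [apply Pos2Nat.is_pos|].
  unfold Q2R; simpl. rewrite INR_IZR_INZ, positive_nat_Z. reflexivity.
Qed.

Lemma rational_quotient z q : (0 < q)%nat -> rational (IZR z / INR q).
Proof.
  intros Hq. apply rational_IZR_mult_rev with (Z.of_nat q); [lia|].
  rewrite <- INR_IZR_INZ. replace (INR q * (IZR z / INR q)) with (IZR z); [apply rational_IZR|].
  field. apply not_0_INR; lia.
Qed.

(** For $B\ge2$ the argument strictly decreases until it is 0, so fuel $m$ suffices for the argument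
    $m$; once 0 is reached, spare fuel is harmless as soon as [delta 0 = 0]. *)
Fixpoint digmap_fuel (b B : nat) (delta : nat -> nat) (fuel m : nat) : nat :=
  match fuel with
  | O => O
  | S f => b * digmap_fuel b B delta f (m / B) + delta (m mod B)
  end.

(* Reads the base-[B] digits [i] of [m] as the base-[b] digits [delta i]; with [b = 1] it is
   the sum of the digits so obtained. *)
Definition digmap (b B : nat) (delta : nat -> nat) (m : nat) : nat := digmap_fuel b B delta m m.

Section Digits.
Local Open Scope nat_scope.
Context (B : nat) (delta : nat -> nat) (HB : 2 <= B) (delta0 : delta 0 = 0).

Lemma digmap_fuel_zero b f : digmap_fuel b B delta f 0 = 0.
Proof.
  induction f as [|f IH]; simpl; [reflexivity|].
  rewrite Nat.Div0.div_0_l, Nat.Div0.mod_0_l, IH, delta0. lia.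
Qed.

Lemma digmap_fuel_enough b f m : m <= f -> digmap_fuel b B delta f m = digmap b B delta m.
Proof.
  revert f. induction m as [m IH] using lt_wf_ind. intros f Hf.
  destruct (Nat.eq_dec m 0) as [->|Hm].
  - unfold digmap. now rewrite !digmap_fuel_zero.
  - destruct f as [|f]; [lia|]. unfold digmap. destruct m as [|m]; [lia|].
    assert (S m / B < S m) by (apply Nat.div_lt; lia). cbn [digmap_fuel].
    rewrite (IH (S m / B)), (IH (S m / B)); lia.
Qed.

Lemma digmap_step b q i : i < B -> digmap b B delta (q * B + i) = b * digmap b B delta q + delta i.
Proof.
  intros Hi. rewrite <- (digmap_fuel_enough b (S (q * B + i))) by lia. cbn [digmap_fuel].
  rewrite Nat.div_add_l, Nat.div_small, Nat.add_0_r by lia.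
  rewrite (Nat.add_comm (q * B)), Nat.Div0.mod_add, Nat.mod_small by lia.
  rewrite digmap_fuel_enough; [reflexivity|nia].
Qed.

Lemma digmap_0 b : digmap b B delta 0 = 0.
Proof. reflexivity. Qed.

Lemma digmap_small b i : i < B -> digmap b B delta i = delta i.
Proof. intros Hi. rewrite <- (Nat.add_0_l i) at 1. change 0 with (0 * B) at 1. rewrite digmap_step, digmap_0; lia. Qed.

(** Low and high digits of the index are read independently. For $b=1$ the weight $b^K$ is 1, so the
    digit sum is additive over the two parts. *)
Lemma digmap_block b K q r : r < B ^ K ->
  digmap b B delta (q * B ^ K + r) = b ^ K * digmap b B delta q + digmap b B delta r.
Proof.
  revert r. induction K as [|K IH]; intros r Hr.
  - simpl in Hr. assert (r = 0) by lia. subst. rewrite digmap_0. simpl. rewrite Nat.mul_1_r, !Nat.add_0_r. reflexivity.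
  - assert (Er : r = r / B * B + r mod B) by (rewrite Nat.mul_comm; apply Nat.div_mod; lia).
    assert (Hm : r mod B < B) by (apply Nat.mod_upper_bound; lia).
    assert (Hd : r / B < B ^ K) by (apply Nat.Div0.div_lt_upper_bound; simpl in Hr; lia).
    rewrite Er at 2. rewrite digmap_step by assumption.
    replace (q * B ^ S K + r) with ((q * B ^ K + r / B) * B + r mod B)
      by (rewrite Er at 3; simpl; ring).
    rewrite digmap_step, IH by assumption. simpl. ring.
Qed.

Context (b : nat) (Hb : 2 <= b) (delta_lt : forall i, i < B -> delta i < b)
  (delta_inc : forall i j, i < j -> j < B -> delta i < delta j).

(** Lexicographic comparison: the higher digits decide because the last one contributes less than
    $b$; if they agree, the last digits decide by monotonicity of [delta]. *)
Lemma digmap_inc m m' : m < m' -> digmap b B delta m < digmap b B delta m'.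
Proof.
  revert m. induction m' as [m' IH] using lt_wf_ind. intros m Hm.
  assert (E : m = m / B * B + m mod B) by (rewrite Nat.mul_comm; apply Nat.div_mod; lia).
  assert (E' : m' = m' / B * B + m' mod B) by (rewrite Nat.mul_comm; apply Nat.div_mod; lia).
  assert (Hi : m mod B < B) by (apply Nat.mod_upper_bound; lia).
  assert (Hi' : m' mod B < B) by (apply Nat.mod_upper_bound; lia).
  rewrite E, E', !digmap_step by assumption.
  assert (Hq : m / B <= m' / B) by (apply Nat.Div0.div_le_mono; lia).
  destruct (Nat.eq_dec (m / B) (m' / B)) as [Eq|Hne].
  - rewrite Eq in *. assert (delta (m mod B) < delta (m' mod B)) by (apply delta_inc; nia). lia.
  - assert (digmap b B delta (m / B) < digmap b B delta (m' / B)) by (apply IH; [apply Nat.div_lt; lia|lia]).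
    assert (delta (m mod B) < b) by auto. nia.
Qed.

Lemma digmap_inj m m' : digmap b B delta m = digmap b B delta m' -> m = m'.
Proof.
  intros H. destruct (lt_eq_lt_dec m m') as [[L|L]|L]; [|assumption|];
    apply digmap_inc in L; lia.
Qed.

Lemma nsum_ext f g K : (forall j, j <= K -> f j = g j) -> nsum f K = nsum g K.
Proof. induction K as [|K IH]; intros H; simpl; [apply H; lia|]. rewrite IH, H; auto with arith. Qed.

Lemma nsum_head f K : nsum f (S K) = f 0 + nsum (fun j => f (S j)) K.
Proof.
  induction K as [|K IH]; [reflexivity|].
  change (nsum f (S K) + f (S (S K)) = f 0 + (nsum (fun j => f (S j)) K + f (S (S K)))). lia.
Qed.

Lemma nsum_scal c f K : nsum (fun j => c * f j) K = c * nsum f K.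
Proof. induction K as [|K IH]; simpl; [reflexivity|]. rewrite IH. ring. Qed.

Lemma nsum_horner (d : nat -> nat) K :
  nsum (fun j => d j * b ^ j) (S K) = b * nsum (fun j => d (S j) * b ^ j) K + d 0.
Proof.
  rewrite nsum_head, <- nsum_scal, Nat.add_comm. f_equal; [|simpl; lia].
  apply nsum_ext. intros. simpl. ring.
Qed.

(** The two sides peel off the same lowest digit. The number 0 is represented by a single digit 0,
    which lies in $D$ as [delta 0 = 0]. *)
Lemma inC_digmap D : (forall x, In x D <-> exists i, i < B /\ delta i = x) ->
  forall x, inC b D x <-> exists m, digmap b B delta m = x.
Proof.
  intros HD x. split.
  - intros [K [d [Hd ->]]]. revert d Hd. induction K as [|K IH]; intros d Hd.
    + destruct (proj1 (HD (d 0)) (Hd 0 (le_n 0))) as [i [Hi Ei]]. exists i.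
      rewrite digmap_small by assumption. simpl. lia.
    + destruct (proj1 (HD (d 0)) (Hd 0 (Nat.le_0_l _))) as [i [Hi Ei]].
      destruct (IH (fun j => d (S j))) as [q Hq]; [intros; apply Hd; lia|].
      exists (q * B + i). now rewrite digmap_step, nsum_horner, Hq, Ei.
  - intros [m <-]. induction m as [m IH] using lt_wf_ind.
    destruct (Nat.eq_dec m 0) as [->|Hm].
    + exists 0, (fun _ => 0). split; [|reflexivity].
      intros. apply HD. exists 0. split; [lia|assumption].
    + assert (E : m = m / B * B + m mod B) by (rewrite Nat.mul_comm; apply Nat.div_mod; lia).
      assert (Hi : m mod B < B) by (apply Nat.mod_upper_bound; lia).
      destruct (IH (m / B)) as [K [d [Hd Ed]]]; [apply Nat.div_lt; lia|].
      exists (S K), (fun j => match j with 0 => delta (m mod B) | S j' => d j' end). split.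
      * intros [|j] Hj; [apply HD; eauto|apply Hd; lia].
      * rewrite nsum_horner, <- Ed. rewrite E at 1. now apply digmap_step.
Qed.

(** Two increasing enumerations of one set agree, by strong induction. The shift [S n] is due to $k$
    being indexed from 1 and [digmap] from 0. *)
Lemma enumeration_digmap k :
  (forall n, 1 <= n -> k n < k (S n)) ->
  (forall x, (exists m, digmap b B delta m = x) <-> exists n, 1 <= n /\ k n = x) ->
  forall n, k (S n) = digmap b B delta n.
Proof.
  intros Hk Hr.
  assert (Hinc : forall n n', n < n' -> k (S n) < k (S n')).
  { intros n n' H. induction H as [|n' H IH]; [apply Hk; lia|].
    eapply Nat.lt_trans; [exact IH|apply Hk; lia]. }
  intros n. induction n as [n IH] using lt_wf_ind.
  destruct (lt_eq_lt_dec (k (S n)) (digmap b B delta n)) as [[L|L]|L]; [|assumption|]; exfalso.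
  - destruct (proj2 (Hr (k (S n)))) as [m Em]; [exists (S n); split; [lia|reflexivity]|].
    destruct (lt_eq_lt_dec m n) as [[L'|L']|L'].
    + assert (H := Hinc _ _ L'). rewrite (IH m L') in H. lia.
    + subst. lia.
    + apply digmap_inc in L'. lia.
  - destruct (proj1 (Hr (digmap b B delta n))) as [[|n'] [Hn' En']]; [eauto|lia|].
    destruct (lt_eq_lt_dec n' n) as [[L'|L']|L'].
    + rewrite (IH n' L') in En'. apply digmap_inj in En'. lia.
    + subst. lia.
    + assert (H := Hinc _ _ L'). lia.
Qed.

Lemma nsum_zero f K K' : K <= K' -> (forall j, K < j -> j <= K' -> f j = 0) -> nsum f K' = nsum f K.
Proof.
  intros HK. induction HK as [|K' HK IH]; intros H; [reflexivity|].
  simpl. rewrite IH, (H (S K')); try lia. intros; apply H; lia.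
Qed.

Lemma digit_large q j : q < j -> digit b q j = 0.
Proof.
  intros H. unfold digit. rewrite Nat.div_small, Nat.Div0.mod_0_l; [reflexivity|].
  assert (j < b ^ j) by (apply Nat.pow_gt_lin_r; lia). lia.
Qed.

Lemma sdig_step q d : d < b -> sdig b (b * q + d) = sdig b q + d.
Proof.
  intros Hd. unfold sdig.
  assert (H0 : digit b (b * q + d) 0 = d).
  { unfold digit. rewrite Nat.pow_0_r, Nat.div_1_r, Nat.add_comm, Nat.mul_comm, Nat.Div0.mod_add.
    now apply Nat.mod_small. }
  assert (HS : forall j, digit b (b * q + d) (S j) = digit b q j).
  { intros j. unfold digit. rewrite Nat.pow_succ_r', <- Nat.Div0.div_div.
    now rewrite (Nat.mul_comm b q), Nat.div_add_l, (Nat.div_small d b), Nat.add_0_r by lia. }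
  (* One vanishing position is appended so that the sum can be peeled at position 0 even when the
     number is 0. *)
  rewrite <- (nsum_zero _ (b * q + d) (S (b * q + d))) by (try lia; intros; apply digit_large; lia).
  rewrite nsum_head, H0, Nat.add_comm. f_equal.
  rewrite (nsum_ext _ (fun j => digit b q j)) by auto.
  apply nsum_zero; [nia|]. intros; apply digit_large; lia.
Qed.

Lemma sdig_digmap m : sdig b (digmap b B delta m) = digmap 1 B delta m.
Proof.
  induction m as [m IH] using lt_wf_ind.
  destruct (Nat.eq_dec m 0) as [->|Hm].
  - rewrite !digmap_0. unfold sdig, digit. simpl. now rewrite Nat.Div0.mod_0_l.
  - assert (E : m = m / B * B + m mod B) by (rewrite Nat.mul_comm; apply Nat.div_mod; lia).
    assert (Hi : m mod B < B) by (apply Nat.mod_upper_bound; lia).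
    rewrite E, !digmap_step, sdig_step, IH by (auto; apply Nat.div_lt; lia). lia.
Qed.

End Digits.

(** Induction on the bound: if the largest admissible value occurs in $D$, it is removed and placed
    at the last index. *)
Lemma sorted_digits (D : list nat) (b : nat) : NoDup D -> (forall x, In x D -> (x < b)%nat) ->
  exists delta : nat -> nat,
    (forall i j, (i < j)%nat -> (j < length D)%nat -> (delta i < delta j)%nat) /\
    (forall x, In x D <-> exists i, (i < length D)%nat /\ delta i = x).
Proof.
  revert D. induction b as [|b IH]; intros D HD Hb.
  - destruct D as [|x D]; [|exfalso; specialize (Hb x (or_introl eq_refl)); lia].
    exists (fun i => i). split; [intros; simpl in *; lia|].
    intros x; split; [intros []|intros [i [Hi _]]; simpl in Hi; lia].
  - destruct (in_dec Nat.eq_dec b D) as [Hin|Hnin].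
    + destruct (in_split _ _ Hin) as [l1 [l2 ->]].
      apply NoDup_remove in HD. destruct HD as [HD Hnin].
      destruct (IH (l1 ++ l2) HD) as [delta [H1 H2]].
      { intros x Hx. assert (x < S b)%nat by (apply Hb; rewrite in_app_iff in *; simpl; tauto).
        assert (x <> b) by (intros ->; contradiction). lia. }
      assert (HL : length (l1 ++ b :: l2) = S (length (l1 ++ l2)))
        by (rewrite !length_app; simpl; lia).
      assert (Hdl : forall i, (i < length (l1 ++ l2))%nat -> (delta i < b)%nat).
      { intros i Hi. assert (Hx : In (delta i) (l1 ++ l2)) by (apply H2; eauto).
        assert (delta i < S b)%nat by (apply Hb; rewrite in_app_iff in *; simpl; tauto).
        assert (delta i <> b) by (intros E; rewrite E in Hx; contradiction). lia. }
      exists (fun i => if i =? length (l1 ++ l2) then b else delta i)%nat. rewrite HL. split.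
      * intros i j Hij Hj. destruct (Nat.eqb_spec i (length (l1 ++ l2))) as [E|E]; [lia|].
        destruct (Nat.eqb_spec j (length (l1 ++ l2))) as [E'|E']; [apply Hdl; lia|apply H1; lia].
      * intros x. split.
        -- intros Hx. destruct (Nat.eq_dec x b) as [->|Hxb].
           ++ exists (length (l1 ++ l2)). rewrite Nat.eqb_refl. split; [lia|reflexivity].
           ++ destruct (proj1 (H2 x)) as [i [Hi Ei]].
              { rewrite in_app_iff in *; simpl in Hx. destruct Hx as [|[]]; try tauto. congruence. }
              exists i. split; [lia|]. destruct (Nat.eqb_spec i (length (l1 ++ l2))); [lia|assumption].
        -- intros [i [Hi Ei]]. destruct (Nat.eqb_spec i (length (l1 ++ l2))) as [E|E].
           ++ subst x. assumption.
           ++ assert (Hx : In x (l1 ++ l2)) by (apply H2; exists i; split; [lia|assumption]).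
              rewrite in_app_iff in *; simpl; tauto.
    + apply IH; [assumption|]. intros x Hx. assert (x < S b)%nat by auto.
      assert (x <> b) by (intros ->; contradiction). lia.
Qed.

(** * Linear phases *)

Lemma Cmod_ee_minus x y : Cmod (ee (x - y) - 1) = Cmod (ee x - ee y).
Proof.
  replace (ee x - ee y)%C with (ee y * (ee (x - y) - 1))%C.
  - now rewrite Cmod_mult, Cmod_ee, Rmult_1_l.
  - replace (ee x) with (ee (y + (x - y))) by (f_equal; ring). rewrite ee_plus. ring.
Qed.

Lemma Cmod_eq_1 z : Cmod (z - 1) = 0 -> z = RtoC 1.
Proof.
  intros H. apply Cmod_eq_0 in H. replace z with ((z - 1) + 1)%C by ring. rewrite H. ring.
Qed.

(** In $w^b-1=(w-1)\sum_{i<b}w^i$ each $w^i$ is within $1/4$ of 1, so the sum has modulus at least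
    $3b/4\ge3/2$. *)
Lemma pow_repelling (w : Complex.C) (b : nat) : (2 <= b)%nat -> Cmod w = 1 ->
  Cmod (w - 1) <= / (4 * INR b) -> 3 / 2 * Cmod (w - 1) <= Cmod (w ^ b - 1).
Proof.
  intros Hb Hw Hs. assert (Hb' : 2 <= INR b) by (apply (le_INR 2 b); exact Hb).
  rewrite <- geom_telescope, Cmod_mult.
  apply Rmult_le_compat_r; [apply Cmod_ge_0|].
  assert (E : csum (fun _ => RtoC 1) b = (csum (fun i => w ^ i) b + csum (fun i => 1 - w ^ i) b)%C).
  { rewrite <- csum_plus. apply csum_ext. intros. ring. }
  assert (H1 : Cmod (csum (fun i => (1 - w ^ i)%C) b) <= INR b * (1 / 4)).
  { apply Cmod_csum_le. intros i Hi.
    replace (1 - w ^ i)%C with (- (w ^ i - 1))%C by ring. rewrite Cmod_opp.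
    eapply Rle_trans; [apply Cmod_pow_sub_1, Hw|].
    apply Rle_trans with (INR b * / (4 * INR b)).
    - apply Rmult_le_compat; try apply pos_INR; try apply Cmod_ge_0; [|assumption].
      apply le_INR; lia.
    - right. field. lra. }
  assert (H2 : INR b <= Cmod (csum (fun i => (w ^ i)%C) b) + Cmod (csum (fun i => (1 - w ^ i)%C) b)).
  { eapply Rle_trans; [|apply Cmod_triangle]. rewrite <- E, csum_const.
    rewrite Cmult_1_r, Cmod_R. apply Rle_abs. }
  lra.
Qed.

Lemma repelling_orbit (w : Complex.C) (b : nat) : (2 <= b)%nat -> Cmod w = 1 ->
  (forall m, Cmod (w ^ (b ^ m) - 1) <= / (4 * INR b)) -> w = RtoC 1.
Proof.
  intros Hb Hw H. assert (Hb' : 2 <= INR b) by (apply (le_INR 2 b); exact Hb).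
  assert (Hg : forall m, (3 / 2) ^ m * Cmod (w - 1) <= Cmod (w ^ (b ^ m) - 1)).
  { induction m as [|m IH]; [simpl; rewrite Cmult_1_r; lra|].
    replace (b ^ S m)%nat with (b ^ m * b)%nat by (simpl; ring). rewrite Cpow_mult_r.
    eapply Rle_trans; [|apply pow_repelling; [exact Hb| |apply H]].
    - simpl. lra.
    - now rewrite Cmod_pow, Hw, pow1. }
  apply Cmod_eq_1. apply Rle_antisym; [|apply Cmod_ge_0]. apply Rnot_lt_le. intros Hp.
  assert (Hq : / (4 * INR b) <= 1).
  { rewrite <- Rinv_1. apply Rinv_le_contravar; lra. }
  (* With $N|w-1|/2>1$, Bernoulli's inequality gives $(3/2)^N|w-1|>1$, against the bound
     $1/(4b)\le1$ on the orbit. *)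
  destruct (archimed_cor1 (Cmod (w - 1) / 2)) as [N [HN HN0]]; [lra|].
  assert (HN' : 0 < INR N) by now apply lt_0_INR.
  assert (Hpow : 1 + INR N * (1 / 2) <= (3 / 2) ^ N).
  { replace (3 / 2) with (1 + 1 / 2) by field. apply poly. lra. }
  specialize (Hg N). specialize (H N).
  assert (1 < INR N * (Cmod (w - 1) / 2)).
  { apply Rmult_lt_reg_l with (/ INR N); [now apply Rinv_0_lt_compat|].
    rewrite <- Rmult_assoc, Rinv_l by lra. lra. }
  nra.
Qed.

(** If $\alpha$ is rational with denominator $q$, the $q$-th power of each factor is one fixed
    number $v\ne1$, whence the distance at least $|v-1|/q$ at every $j$. If $\alpha$ is irrational
    and all factors beyond $J$ were within $1/(8b)$ of 1, the quotients of consecutive ones would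
    form an orbit $w^{b^m}$ within $1/(4b)$ of 1, so $w=1$ and $d\alpha b^J(b-1)$ would be an
    integer. *)
Lemma orbit_far_from_1 (b d : nat) (alpha beta : R) : (2 <= b)%nat -> (1 <= d)%nat ->
  ~ (rational alpha /\ rational beta) ->
  exists eps, 0 < eps /\ forall J, exists j, (J <= j)%nat /\
    eps <= Cmod (ee (INR d * (alpha * INR (b ^ j) + beta)) - 1).
Proof.
  intros Hb Hd Hirr. assert (Hb' : 2 <= INR b) by (apply (le_INR 2 b); exact Hb).
  destruct (classic (rational alpha)) as [Ha|Ha].
  - assert (Hbe : ~ rational beta) by tauto. clear Hirr.
    destruct (rational_fraction _ Ha) as [z [q [Hq ->]]].
    assert (Hq' : 0 < INR q) by now apply lt_0_INR.
    set (v := ee (INR q * (INR d * beta))).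
    assert (Hv : 0 < Cmod (v - 1)).
    { destruct (Cmod_ge_0 (v - 1)) as [H|H]; [exact H|exfalso].
      symmetry in H. apply Cmod_eq_1, ee_eq_1 in H. destruct H as [y Hy]. apply Hbe.
      apply rational_IZR_mult_rev with (Z.of_nat d); [lia|].
      apply rational_IZR_mult_rev with (Z.of_nat q); [lia|].
      rewrite <- !INR_IZR_INZ, Hy. apply rational_IZR. }
    exists (Cmod (v - 1) / INR q). split; [now apply Rdiv_lt_0_compat|].
    intros J. exists J. split; [lia|].
    assert (E : v = (ee (INR d * (IZR z / INR q * INR (b ^ J) + beta)) ^ q)%C).
    { rewrite <- ee_INR. unfold v.
      replace (INR q * (INR d * (IZR z / INR q * INR (b ^ J) + beta)))
        with (INR q * (INR d * beta) + IZR (Z.of_nat d * z * Z.of_nat (b ^ J))).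
      - now rewrite ee_add_IZR.
      - rewrite !mult_IZR, <- !INR_IZR_INZ. field. lra. }
    rewrite E. apply Rmult_le_reg_l with (INR q); [exact Hq'|].
    replace (INR q * (_ / INR q)) with (Cmod (ee (INR d * (IZR z / INR q * INR (b ^ J) + beta)) ^ q - 1))
      by (field; lra).
    apply Cmod_pow_sub_1, Cmod_ee.
  - exists (/ (8 * INR b)). split; [apply Rinv_0_lt_compat; lra|]. intros J.
    apply NNPP. intros Hno.
    assert (Hlt : forall j, (J <= j)%nat ->
      Cmod (ee (INR d * (alpha * INR (b ^ j) + beta)) - 1) < / (8 * INR b)).
    { intros j Hj. apply Rnot_le_lt. intros H. apply Hno. eauto. }
    set (w := ee (INR d * (alpha * INR (b ^ S J) + beta) - INR d * (alpha * INR (b ^ J) + beta))).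
    assert (Hw : w = RtoC 1).
    { apply (repelling_orbit w b Hb); [apply Cmod_ee|]. intros m.
      unfold w. rewrite <- ee_INR.
      replace (INR (b ^ m) * (INR d * (alpha * INR (b ^ S J) + beta) - INR d * (alpha * INR (b ^ J) + beta)))
        with (INR d * (alpha * INR (b ^ (S (J + m))) + beta) - INR d * (alpha * INR (b ^ (J + m)) + beta)).
      - rewrite Cmod_ee_minus.
        assert (H1 := Hlt (S (J + m)) ltac:(lia)). assert (H2 := Hlt (J + m)%nat ltac:(lia)).
        match goal with |- Cmod (?u1 - ?u2) <= _ =>
          replace (u1 - u2)%C with ((u1 - 1) + - (u2 - 1))%C by ring end.
        eapply Rle_trans; [apply Cmod_triangle|]. rewrite Cmod_opp.
        replace (/ (4 * INR b)) with (/ (8 * INR b) + / (8 * INR b)) by (field; lra). lra.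
      - rewrite !Nat.pow_succ_r', Nat.pow_add_r, !mult_INR. ring. }
    apply ee_eq_1 in Hw. destruct Hw as [y Hy]. apply Ha.
    apply rational_IZR_mult_rev with (Z.of_nat d * Z.of_nat (b ^ J * (b - 1)))%Z.
    { assert (b ^ J <> 0)%nat by (apply Nat.pow_nonzero; lia). nia. }
    replace (IZR _ * alpha) with (IZR y); [apply rational_IZR|].
    rewrite <- Hy, mult_IZR, <- !INR_IZR_INZ, Nat.pow_succ_r', !mult_INR, minus_INR by lia.
    simpl. ring.
Qed.

(** The parallelogram law $|1+u|^2+|u-1|^2=4$ gives
    $|1+u|^2\le4-\varepsilon^2\le(2-\varepsilon^2/4)^2$. *)
Lemma Cmod_1_plus_unit u eps : Cmod u = 1 -> 0 < eps -> eps <= Cmod (u - 1) ->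
  Cmod (1 + u) <= 2 - eps ^ 2 / 4.
Proof.
  intros Hu He Hd.
  assert (H1 : Cmod u ^ 2 = 1) by (rewrite Hu; ring).
  assert (H2 := Cmod2_alt (1 + u)). assert (H3 := Cmod2_alt (u - 1)).
  rewrite Cmod2_alt in H1. destruct u as [x y]. unfold Re, Im in *; simpl fst in *; simpl snd in *.
  set (c := Cmod (1 + (x, y))) in *. set (e := Cmod ((x, y) - 1)) in *.
  assert (0 <= c) by apply Cmod_ge_0.
  assert (Hsum : c ^ 2 + e ^ 2 = 4).
  { rewrite H2, H3. nra. }
  assert (eps ^ 2 <= e ^ 2) by (apply pow_incr; lra).
  assert (0 <= c ^ 2) by apply pow2_ge_0.
  apply Rnot_lt_le. intros Hlt. assert (0 <= 2 - eps ^ 2 / 4) by lra.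
  assert ((2 - eps ^ 2 / 4) ^ 2 < c ^ 2) by nra.
  nra.
Qed.

(** * Cancellation over digit blocks *)

Lemma pow2_le_reg x y : 0 <= y -> x ^ 2 <= y ^ 2 -> x <= y.
Proof. intros Hy H. apply Rnot_lt_le. intros Hlt. nra. Qed.

Lemma eventually_forall (P : nat -> nat -> Prop) J :
  (forall j, (j < J)%nat -> exists K0, forall K, (K0 <= K)%nat -> P j K) ->
  exists K0, forall K, (K0 <= K)%nat -> forall j, (j < J)%nat -> P j K.
Proof.
  induction J as [|J IH]; intros H; [exists 0%nat; intros; lia|].
  destruct IH as [K1 H1]; [intros; apply H; lia|].
  destruct (H J) as [K2 H2]; [lia|].
  exists (max K1 K2). intros K HK j Hj. destruct (Nat.eq_dec j J) as [->|Hne].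
  - apply H2; lia.
  - apply H1; lia.
Qed.

Definition fdiff (u v : Z) (F : R -> R -> R) (x y : R) : R := F (x + IZR u) (y + IZR v) - F x y.

(* A polynomial of total degree [n + 1] with an irrational coefficient of that degree satisfies
   this. The differences of [F] that fail to satisfy the predicate for [n] have collinear steps. *)
Fixpoint irr_phase (n : nat) (F : R -> R -> R) : Prop :=
  match n with
  | O => exists alpha beta c, (forall x y, F x y = alpha * x + beta * y + c) /\
           ~ (rational alpha /\ rational beta)
  | S m => forall u v u' v' : Z, (u * v' - u' * v <> 0)%Z ->
           irr_phase m (fdiff u v F) \/ irr_phase m (fdiff u' v' F)
  end.

(** Only $x$ is dilated: passing to higher digits scales the number by a power of $b$ but leaves the
    digit sum unscaled. Steps $(u,v)$ of $G$ correspond to steps $(cu,v)$ of $F$, so determinants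
    are multiplied by $c\ne0$. *)
Lemma irr_phase_affine n F G (c : Z) x0 y0 : c <> 0%Z ->
  (forall x y, G x y = F (IZR c * x + x0) (y + y0)) -> irr_phase n F -> irr_phase n G.
Proof.
  intros Hc. revert F G. induction n as [|n IH]; intros F G HG HF.
  - destruct HF as [alpha [beta [e [HF Hirr]]]].
    exists (IZR c * alpha), beta, (alpha * x0 + beta * y0 + e). split.
    + intros. rewrite HG, HF. ring.
    + intros [H1 H2]. apply Hirr. split; [|assumption]. now apply rational_IZR_mult_rev with c.
  - assert (Hd : forall u v x y, fdiff u v G x y = fdiff (c * u) v F (IZR c * x + x0) (y + y0)).
    { intros. unfold fdiff. rewrite !HG, mult_IZR. f_equal. f_equal; ring. }
    intros u v u' v' Hdet.
    destruct (HF (c * u) v (c * u') v')%Z as [H|H].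
    + nia.
    + left. revert H. apply IH, Hd.
    + right. revert H. apply IH, Hd.
Qed.

(** A bad nonzero step $(u_0,v_0)$ forces all steps not parallel to it to be good, which gives the
    normal vector $(v_0,-u_0)$. If no nonzero step is bad, any line will do. *)
Lemma irr_phase_exceptional_line n F : irr_phase (S n) F ->
  exists A A' : Z, ~ (A = 0%Z /\ A' = 0%Z) /\
    forall u v : Z, (A * u + A' * v <> 0)%Z -> irr_phase n (fdiff u v F).
Proof.
  intros HF.
  destruct (classic (exists u v : Z, ~ (u = 0%Z /\ v = 0%Z) /\ ~ irr_phase n (fdiff u v F)))
    as [[u0 [v0 [H0 Hn]]]|Hn].
  - exists v0, (- u0)%Z. split; [lia|]. intros u v Huv.
    destruct (HF u v u0 v0) as [H|H]; [lia|assumption|contradiction].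
  - exists 1%Z, 0%Z. split; [lia|]. intros u v Huv. apply NNPP. intros H.
    apply Hn. exists u, v. split; [lia|assumption].
Qed.

Section Cancellation.
Context (b B : nat) (delta : nat -> nat) (Hb : (2 <= b)%nat) (HB : (2 <= B)%nat)
  (delta0 : delta 0%nat = 0%nat) (delta1 : (1 <= delta 1)%nat).

Let phi (r : nat) : R := INR (digmap b B delta r).
Let sig (r : nat) : R := INR (digmap 1 B delta r).

(** The threshold [K0] precedes the real translations [x] and [y]: this uniformity over blocks is
    what the induction on the degree carries along. *)
Definition cancelling (F : R -> R -> R) : Prop :=
  forall eps, 0 < eps -> exists K0, forall K, (K0 <= K)%nat -> forall x y,
    Cmod (csum (fun r => ee (F (phi r + x) (sig r + y))) (B ^ K)) <= eps * INR (B ^ K).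

Lemma INR_pow_pos K : 0 < INR (B ^ K).
Proof. apply lt_0_INR, Nat.neq_0_lt_0, Nat.pow_nonzero. lia. Qed.

Lemma phi_block K q r : (r < B ^ K)%nat -> phi (q * B ^ K + r) = INR (b ^ K) * phi q + phi r.
Proof.
  intros H. unfold phi. rewrite (digmap_block B delta HB delta0) by assumption.
  now rewrite plus_INR, mult_INR.
Qed.

Lemma sig_block K q r : (r < B ^ K)%nat -> sig (q * B ^ K + r) = sig q + sig r.
Proof.
  intros H. unfold sig. rewrite (digmap_block B delta HB delta0) by assumption.
  now rewrite Nat.pow_1_l, Nat.mul_1_l, plus_INR.
Qed.

Let linsum (alpha beta : R) (K : nat) : Complex.C :=
  csum (fun r => ee (alpha * phi r + beta * sig r)) (B ^ K).

Lemma linsum_S alpha beta K :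
  linsum alpha beta (S K) =
  (csum (fun q => ee (INR (delta q) * (alpha * INR (b ^ K) + beta))) B * linsum alpha beta K)%C.
Proof.
  unfold linsum. change (B ^ S K)%nat with (B * B ^ K)%nat. rewrite csum_mul, csum_mult.
  apply csum_ext. intros q Hq. apply csum_ext. intros r Hr.
  rewrite phi_block, sig_block by assumption. rewrite <- ee_plus. f_equal.
  unfold phi at 1, sig at 1. rewrite !(digmap_small B delta HB delta0) by assumption. ring.
Qed.

Lemma digit_sum_le theta : Cmod (csum (fun q => ee (INR (delta q) * theta)) B) <= INR B.
Proof.
  rewrite <- (Rmult_1_r (INR B)). apply Cmod_csum_le. intros. rewrite Cmod_ee. lra.
Qed.

(** The gain comes from the two terms with digits 0 and [delta 1] alone; the other $B-2$ terms are
    bounded trivially. *)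
Lemma digit_sum_lt theta eps : 0 < eps -> eps <= Cmod (ee (INR (delta 1) * theta) - 1) ->
  Cmod (csum (fun q => ee (INR (delta q) * theta)) B) <= INR B - eps ^ 2 / 4.
Proof.
  intros He H. replace B with (2 + (B - 2))%nat at 1 by lia. rewrite csum_add.
  eapply Rle_trans; [apply Cmod_triangle|].
  replace (INR B - eps ^ 2 / 4) with ((2 - eps ^ 2 / 4) + INR (B - 2) * 1)
    by (rewrite minus_INR by lia; simpl (INR 2); ring).
  apply Rplus_le_compat.
  - simpl csum. rewrite delta0. simpl (INR 0). rewrite Rmult_0_l, ee_0, Cplus_0_l.
    apply Cmod_1_plus_unit; [apply Cmod_ee|assumption|assumption].
  - apply Cmod_csum_le. intros. rewrite Cmod_ee. lra.
Qed.

(** Each further digit position brings a factor of modulus at most $B$, so the normalised sum cannot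
    grow. *)
Lemma linsum_decay alpha beta K K' eps : (K <= K')%nat ->
  Cmod (linsum alpha beta K) <= eps * INR (B ^ K) ->
  Cmod (linsum alpha beta K') <= eps * INR (B ^ K').
Proof.
  intros HK H. induction HK as [|K' HK IH]; [assumption|].
  rewrite linsum_S, Cmod_mult. rewrite Nat.pow_succ_r', mult_INR.
  apply Rle_trans with (INR B * (eps * INR (B ^ K'))); [|right; ring].
  apply Rmult_le_compat; try apply Cmod_ge_0; [apply digit_sum_le|assumption].
Qed.

Lemma linsum_small alpha beta : ~ (rational alpha /\ rational beta) ->
  forall eta, 0 < eta -> exists K0, forall K, (K0 <= K)%nat ->
    Cmod (linsum alpha beta K) <= eta * INR (B ^ K).
Proof.
  intros Hirr eta Heta.
  destruct (orbit_far_from_1 b (delta 1) alpha beta Hb delta1 Hirr) as [eps [He Hfar]].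
  assert (HB' : 2 <= INR B) by (apply (le_INR 2 B); exact HB).
  (* The gain at one good digit position. There are infinitely many such positions, so any power of
     [rho] is reached; [eps] is at most 2, being a lower bound for a distance between unit numbers,
     which makes [rho] nonnegative. *)
  set (rho := (INR B - eps ^ 2 / 4) / INR B).
  assert (Hrho : 0 <= rho < 1).
  { destruct (Hfar 0%nat) as [j [_ Hj]].
    assert (eps <= 2).
    { eapply Rle_trans; [exact Hj|]. unfold Cminus. eapply Rle_trans; [apply Cmod_triangle|].
      rewrite Cmod_ee, Cmod_opp, Cmod_1. lra. }
    assert (0 < eps ^ 2 <= 4) by nra.
    assert (E : rho * INR B = INR B - eps ^ 2 / 4) by (unfold rho; field; lra).
    split; [apply Rmult_le_reg_r with (INR B)|apply Rmult_lt_reg_r with (INR B)]; lra. }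
  assert (H : forall n, exists K, Cmod (linsum alpha beta K) <= rho ^ n * INR (B ^ K)).
  { induction n as [|n [K HK]].
    - exists 0%nat. unfold linsum. simpl. rewrite Cplus_0_l, Cmod_ee. lra.
    - destruct (Hfar K) as [j [Hj Hfj]]. exists (S j).
      assert (H1 := linsum_decay _ _ _ _ _ Hj HK).
      rewrite linsum_S, Cmod_mult, Nat.pow_succ_r', mult_INR.
      apply Rle_trans with ((INR B - eps ^ 2 / 4) * (rho ^ n * INR (B ^ j))).
      + apply Rmult_le_compat; try apply Cmod_ge_0; [now apply digit_sum_lt|assumption].
      + right. simpl (rho ^ S n). unfold rho at 2. field. lra. }
  destruct (pow_lt_1_zero rho) with (y := eta) as [n Hn]; [rewrite Rabs_pos_eq; lra|assumption|].
  destruct (H n) as [K HK]. exists K. intros K' HK'.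
  apply linsum_decay with K; [assumption|]. eapply Rle_trans; [exact HK|].
  apply Rmult_le_compat_r; [apply pos_INR|].
  specialize (Hn n (le_n n)). apply Rabs_def2 in Hn. lra.
Qed.

Lemma cancelling_affine F : irr_phase 0 F -> cancelling F.
Proof.
  intros [alpha [beta [c [HF Hirr]]]] eps Heps.
  destruct (linsum_small alpha beta Hirr eps Heps) as [K0 HK0]. exists K0. intros K HK x y.
  rewrite (csum_ext _ (fun r => ee (alpha * x + beta * y + c) * ee (alpha * phi r + beta * sig r))%C).
  - rewrite csum_scal, Cmod_mult, Cmod_ee, Rmult_1_l. now apply HK0.
  - intros r _. rewrite <- ee_plus, HF. f_equal. ring.
Qed.

Let diffphi (r r' : nat) : Z := (Z.of_nat (digmap b B delta r) - Z.of_nat (digmap b B delta r'))%Z.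
Let diffsig (r r' : nat) : Z := (Z.of_nat (digmap 1 B delta r) - Z.of_nat (digmap 1 B delta r'))%Z.

Lemma IZR_diffphi r r' : IZR (diffphi r r') = phi r - phi r'.
Proof. unfold diffphi, phi. now rewrite minus_IZR, <- !INR_IZR_INZ. Qed.

Lemma IZR_diffsig r r' : IZR (diffsig r r') = sig r - sig r'.
Proof. unfold diffsig, sig. now rewrite minus_IZR, <- !INR_IZR_INZ. Qed.

(* Fejer-type detection: [W = 0] forces [sum_(r < m) ee (r * gamma * W) = m], while the second
   moment of that sum is small as [r * gamma * W] is, for [r <> 0], an irrational linear phase. *)
Lemma concentration gamma (A A' : Z) : ~ rational gamma -> ~ (A = 0%Z /\ A' = 0%Z) ->
  forall eps, 0 < eps -> exists K, forall x',
    rs (fun x => if Z.eq_dec (A * diffphi x x' + A' * diffsig x x') 0 then 1 else 0) (B ^ K)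
    <= eps * INR (B ^ K).
Proof.
  intros Hg HA eps Heps.
  (* The diagonal terms will contribute the proportion $1/m<\varepsilon/2$, the off-diagonal ones at
     most $\varepsilon/2$. *)
  destruct (archimed_cor1 (eps / 2)) as [m [Hm Hm0]]; [lra|].
  assert (Hm' : 0 < INR m) by now apply lt_0_INR.
  destruct (eventually_forall (fun r K => forall r', (r' < m)%nat -> r <> r' -> forall x y,
      Cmod (csum (fun i => ee ((INR r - INR r') * gamma * (IZR A * (phi i + x) + IZR A' * (sig i + y)))) (B ^ K))
      <= eps / 2 * INR (B ^ K)) m) as [K HK].
  { intros r Hr.
    destruct (eventually_forall (fun r' K => r <> r' -> forall x y,
      Cmod (csum (fun i => ee ((INR r - INR r') * gamma * (IZR A * (phi i + x) + IZR A' * (sig i + y)))) (B ^ K))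
      <= eps / 2 * INR (B ^ K)) m) as [K HK]; [|exists K; intros; now apply HK].
    intros r' Hr'. destruct (Nat.eq_dec r r') as [E|E]; [exists 0%nat; intros; contradiction|].
    destruct (cancelling_affine (fun x y => (INR r - INR r') * gamma * (IZR A * x + IZR A' * y))) with (eps := eps / 2)
      as [K HK]; [|lra|exists K; intros; now apply HK].
    (* As $r\ne r'$ and $(A,A')\ne(0,0)$, one of the two slopes is a nonzero integer multiple of
       [gamma]. *)
    exists (IZR ((Z.of_nat r - Z.of_nat r') * A) * gamma), (IZR ((Z.of_nat r - Z.of_nat r') * A') * gamma), 0.
    split.
    - intros. rewrite !mult_IZR, minus_IZR, <- !INR_IZR_INZ. ring.
    - intros [H1 H2]. apply Hg.
      destruct (Z.eq_dec A 0) as [E0|E0].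
      + apply rational_IZR_mult_rev in H2; [assumption|nia].
      + apply rational_IZR_mult_rev in H1; [assumption|nia]. }
  exists K. intros x'. specialize (HK K (le_n K)).
  set (L := INR (B ^ K)) in *. assert (HL : 0 < L) by apply INR_pow_pos.
  set (W := fun x => (A * diffphi x x' + A' * diffsig x x')%Z).
  set (a := fun r x => ee (INR r * (gamma * IZR (W x)))).
  (* The index [x'] enters only through a translation, so a single [K] serves all [x']. *)
  assert (HW : forall x, IZR (W x) = IZR A * (phi x + - phi x') + IZR A' * (sig x + - sig x')).
  { intros. unfold W. rewrite plus_IZR, !mult_IZR, IZR_diffphi, IZR_diffsig. ring. }
  assert (H1 : INR m ^ 2 * rs (fun x => if Z.eq_dec (W x) 0 then 1 else 0) (B ^ K)
               <= rs (fun x => Cmod (csum (fun r => a r x) m) ^ 2) (B ^ K)).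
  { rewrite <- rs_scal. apply rs_le. intros x _. destruct (Z.eq_dec (W x) 0) as [E|E].
    - rewrite (csum_ext _ (fun _ => RtoC 1)).
      + rewrite csum_const, Cmult_1_r, Cmod_R, Rabs_pos_eq by lra. lra.
      + intros r _. unfold a. rewrite E, !Rmult_0_r. apply ee_0.
    - rewrite Rmult_0_r. apply pow2_ge_0. }
  assert (H2 : rs (fun x => Cmod (csum (fun r => a r x) m) ^ 2) (B ^ K)
               <= INR m * (L + INR m * (eps / 2 * L))).
  { eapply Rle_trans; [apply rs_Cmod2_le|]. apply rs_le_const. intros r Hr.
    eapply Rle_trans.
    - apply rs_le with (g := fun r' => (if Nat.eq_dec r r' then L else 0) + eps / 2 * L).
      intros r' Hr'. destruct (Nat.eq_dec r r') as [E|E].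
      + apply Rle_trans with (L * 1); [|nra]. apply Cmod_csum_le. intros.
        unfold a. rewrite Cmod_mult, Cmod_conj, !Cmod_ee. lra.
      + rewrite Rplus_0_l.
        rewrite (csum_ext _ (fun i => ee ((INR r - INR r') * gamma * (IZR A * (phi i + - phi x') + IZR A' * (sig i + - sig x'))))).
        * now apply HK.
        * intros i _. unfold a. rewrite <- ee_minus, <- HW. f_equal. ring.
    - rewrite rs_plus, rs_const. apply Rplus_le_compat_r.
      rewrite (rs_single _ r m) by (auto; intros i _ Hi; destruct (Nat.eq_dec r i); congruence).
      destruct (Nat.eq_dec r r); [lra|congruence]. }
  set (N := rs _ (B ^ K)) in *. fold W.
  apply Rmult_le_reg_l with (INR m ^ 2); [nra|].
  eapply Rle_trans; [exact H1|]. eapply Rle_trans; [exact H2|].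
  apply Rle_trans with (INR m ^ 2 * (/ INR m * L + eps / 2 * L)).
  - right. field. lra.
  - apply Rmult_le_compat_l; [nra|]. nra.
Qed.

(** A van der Corput step with indices [y * B ^ K1 + x]: Cauchy's inequality over the high part [y],
    then expansion over pairs [x], [x'] of low parts. Pairs off the exceptional line leave a phase
    in [y] to which the induction hypothesis applies; those on it are few by [concentration], for
    which [gamma] supplies an irrational number. *)
Lemma cancelling_step gamma n : ~ rational gamma ->
  (forall G, irr_phase n G -> cancelling G) -> forall F, irr_phase (S n) F -> cancelling F.
Proof.
  intros Hg IH F HF eps Heps.
  destruct (irr_phase_exceptional_line n F HF) as [A [A' [HA Hline]]].
  (* After squaring, pairs on the line and pairs off it may each contribute half of
     $\varepsilon^2$. *)
  assert (He1 : 0 < eps ^ 2 / 2) by nra. set (e1 := eps ^ 2 / 2) in *.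
  destruct (concentration gamma A A' Hg HA e1 He1) as [K1 HK1].
  set (W := fun x x' => (A * diffphi x x' + A' * diffsig x x')%Z).
  set (L1 := INR (B ^ K1)) in *. assert (HL1 : 0 < L1) by apply INR_pow_pos.
  (* The phase difference as a function of the high part, whose number is weighted by $b^{K_1}$; it
     is a difference of [F] with step ([diffphi x x'], [diffsig x x']), composed with an affine
     map. *)
  set (G := fun x x' z1 z2 => F (INR (b ^ K1) * z1 + phi x) (z2 + sig x)
                              - F (INR (b ^ K1) * z1 + phi x') (z2 + sig x')).
  assert (HbK : INR (b ^ K1) <> 0) by (apply not_0_INR, Nat.pow_nonzero; lia).
  assert (HG : forall x x', W x x' <> 0%Z -> irr_phase n (G x x')).
  { intros x x' HW. apply Hline in HW. revert HW.
    apply irr_phase_affine with (c := Z.of_nat (b ^ K1)) (x0 := phi x') (y0 := sig x').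
    - intros E. apply HbK. now rewrite INR_IZR_INZ, E.
    - intros z1 z2. unfold fdiff, G. rewrite IZR_diffphi, IZR_diffsig, <- INR_IZR_INZ.
      f_equal. f_equal; ring. }
  destruct (eventually_forall (fun x K => forall x', (x' < B ^ K1)%nat -> W x x' <> 0%Z -> forall X Y,
      Cmod (csum (fun y => ee (G x x' (phi y + X) (sig y + Y))) (B ^ K)) <= e1 * INR (B ^ K)) (B ^ K1))
    as [K2 HK2].
  { intros x Hx.
    destruct (eventually_forall (fun x' K => W x x' <> 0%Z -> forall X Y,
      Cmod (csum (fun y => ee (G x x' (phi y + X) (sig y + Y))) (B ^ K)) <= e1 * INR (B ^ K)) (B ^ K1))
      as [K HK]; [|exists K; intros; now apply HK].
    intros x' Hx'. destruct (Z.eq_dec (W x x') 0) as [E|E]; [exists 0%nat; intros; contradiction|].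
    destruct (IH (G x x') (HG x x' E) e1 He1) as [K HK]. exists K. intros. now apply HK. }
  exists (K2 + K1)%nat. intros K HK X Y.
  replace K with ((K - K1) + K1)%nat by lia. rewrite Nat.pow_add_r.
  specialize (HK2 (K - K1)%nat ltac:(lia)). set (M := (K - K1)%nat) in *.
  set (L2 := INR (B ^ M)) in *. assert (HL2 : 0 < L2) by apply INR_pow_pos.
  rewrite csum_mul, mult_INR. fold L1 L2.
  set (a := fun x y => ee (F (phi (y * B ^ K1 + x) + X) (sig (y * B ^ K1 + x) + Y))).
  apply pow2_le_reg; [apply Rmult_le_pos; [lra|nra]|].
  eapply Rle_trans; [apply (Cmod_csum_cauchy (fun y => csum (fun x => a x y) (B ^ K1)))|]. fold L2.
  apply Rle_trans with (L2 * (L1 * (e1 * L1 * L2 + L1 * (e1 * L2)))); [|unfold e1; right; field].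
  apply Rmult_le_compat_l; [lra|].
  eapply Rle_trans; [apply rs_Cmod2_le|].
  (* The pair sum is ordered so that [x'] is fixed, as in [concentration]. *)
  rewrite rs_exch. apply rs_le_const. intros x' Hx'.
  eapply Rle_trans.
  - apply rs_le with (g := fun x => L2 * (if Z.eq_dec (W x x') 0 then 1 else 0) + e1 * L2).
    intros x Hx. destruct (Z.eq_dec (W x x') 0) as [E|E].
    + apply Rle_trans with (L2 * 1); [|nra]. apply Cmod_csum_le. intros.
      unfold a. rewrite Cmod_mult, Cmod_conj, !Cmod_ee. lra.
    + rewrite Rmult_0_r, Rplus_0_l.
      (* The translation [X] is divided by $b^{K_1}$ to pass inside the dilation; real translations
         are needed here. *)
      rewrite (csum_ext _ (fun y => ee (G x x' (phi y + X / INR (b ^ K1)) (sig y + Y)))).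
      * now apply HK2.
      * intros y _. unfold a. rewrite <- ee_minus. unfold G.
        rewrite !phi_block, !sig_block by assumption.
        f_equal; f_equal; f_equal; try ring; field; assumption.
  - rewrite rs_plus, rs_const, rs_scal. apply Rplus_le_compat; [|fold L1; lra].
    rewrite Rmult_comm. apply Rmult_le_compat_r; [lra|]. apply HK1.
Qed.

Lemma irr_phase_cancelling gamma n F : ~ rational gamma -> irr_phase n F -> cancelling F.
Proof.
  intros Hg. revert F. induction n as [|n IH].
  - apply cancelling_affine.
  - now apply cancelling_step with gamma.
Qed.

End Cancellation.

(** * Polynomial phases *)

(** Polynomial functions of total degree below [n]. The strict bound accommodates the zero function
    at [n = 0]; closure under pointwise equality stands in for extensionality. *)
Inductive deg_lt (n : nat) : (R -> R -> R) -> Prop :=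
| deg_lt_zero : deg_lt n (fun _ _ => 0)
| deg_lt_mono c i j : (i + j < n)%nat -> deg_lt n (fun x y => c * x ^ i * y ^ j)
| deg_lt_add F G : deg_lt n F -> deg_lt n G -> deg_lt n (fun x y => F x y + G x y)
| deg_lt_ext F G : (forall x y, F x y = G x y) -> deg_lt n F -> deg_lt n G.

Lemma deg_lt_le n m F : (n <= m)%nat -> deg_lt n F -> deg_lt m F.
Proof.
  intros Hnm. induction 1 as [|c i j H|F G _ IF _ IG|F G E _ IF].
  - apply deg_lt_zero.
  - apply deg_lt_mono. lia.
  - now apply deg_lt_add.
  - now apply deg_lt_ext with F.
Qed.

Lemma deg_lt_scal n a F : deg_lt n F -> deg_lt n (fun x y => a * F x y).
Proof.
  induction 1 as [|c i j H|F G _ IF _ IG|F G E _ IF].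
  - apply deg_lt_ext with (fun _ _ => 0); [intros; ring|apply deg_lt_zero].
  - apply deg_lt_ext with (fun x y => (a * c) * x ^ i * y ^ j); [intros; ring|now apply deg_lt_mono].
  - apply deg_lt_ext with (fun x y => a * F x y + a * G x y); [intros; ring|now apply deg_lt_add].
  - apply deg_lt_ext with (fun x y => a * F x y); [intros; now rewrite E|assumption].
Qed.

Lemma deg_lt_mult n m F G : deg_lt n F -> deg_lt m G -> deg_lt (n + m - 1) (fun x y => F x y * G x y).
Proof.
  intros HF HG. induction HF as [|c i j H|F F' _ IF _ IF'|F F' E _ IF].
  - apply deg_lt_ext with (fun _ _ => 0); [intros; ring|apply deg_lt_zero].
  - induction HG as [|c' i' j' H'|G G' _ IG _ IG'|G G' E _ IG].
    + apply deg_lt_ext with (fun _ _ => 0); [intros; ring|apply deg_lt_zero].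
    + apply deg_lt_ext with (fun x y => (c * c') * x ^ (i + i') * y ^ (j + j')).
      * intros. rewrite !pow_add. ring.
      * apply deg_lt_mono. lia.
    + eapply deg_lt_ext; [|apply deg_lt_add; [exact IG|exact IG']]. intros; simpl; ring.
    + eapply deg_lt_ext; [|exact IG]. intros; simpl. now rewrite E.
  - eapply deg_lt_ext; [|apply deg_lt_add; [exact IF|exact IF']]. intros; simpl; ring.
  - eapply deg_lt_ext; [|exact IF]. intros; simpl. now rewrite E.
Qed.

Lemma deg_lt_rs n m (F : nat -> R -> R -> R) : (forall i, (i < m)%nat -> deg_lt n (F i)) ->
  deg_lt n (fun x y => rs (fun i => F i x y) m).
Proof.
  induction m as [|m IH]; intros H; simpl; [apply deg_lt_zero|].
  apply deg_lt_add; [apply IH; auto|apply H; lia].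
Qed.

Lemma deg_lt_1 F : deg_lt 1 F -> forall x y, F x y = F 0 0.
Proof.
  induction 1 as [|c i j H|F G _ IF _ IG|F G E _ IF]; intros x y.
  - reflexivity.
  - assert (i = 0%nat) as -> by lia. assert (j = 0%nat) as -> by lia. reflexivity.
  - now rewrite IF, IG.
  - now rewrite <- !E.
Qed.

Lemma deg_lt_xpow i n : (i < n)%nat -> deg_lt n (fun x _ => x ^ i).
Proof.
  intros H. apply deg_lt_ext with (fun x y => 1 * x ^ i * y ^ 0); [intros; simpl; ring|].
  apply deg_lt_mono; lia.
Qed.

Lemma deg_lt_swap n F : deg_lt n F -> deg_lt n (fun x y => F y x).
Proof.
  induction 1 as [|c i j H|F G _ IF _ IG|F G E _ IF].
  - apply deg_lt_zero.
  - apply deg_lt_ext with (fun x y => c * x ^ j * y ^ i); [intros; ring|apply deg_lt_mono; lia].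
  - now apply deg_lt_add.
  - now apply deg_lt_ext with (fun x y => F y x).
Qed.

(** The remainder of the first-order expansion. Passing from exponent $i+1$ to $i+2$ multiplies it
    by $x+u$ and adds $(i+1)u^2x^i$. For $i=0$ the truncated exponent is harmless, its coefficient
    being 0. *)
Lemma pow_shift_deg u i :
  deg_lt (i - 1) (fun x _ => (x + u) ^ i - x ^ i - INR i * u * x ^ (i - 1)).
Proof.
  induction i as [|i IH].
  - eapply deg_lt_ext; [|apply deg_lt_zero]. intros; simpl; ring.
  - destruct i as [|i].
    + eapply deg_lt_ext; [|apply deg_lt_zero]. intros; simpl; ring.
    + set (r := fun x (_ : R) => (x + u) ^ S i - x ^ S i - INR (S i) * u * x ^ (S i - 1)) in *.
      replace (S (S i) - 1)%nat with (S i) by lia.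
      assert (IH' : deg_lt (S i) (fun x y => x ^ 1 * r x y)).
      { eapply deg_lt_le; [|apply deg_lt_mult; [apply (deg_lt_xpow 1 2); lia|exact IH]]. lia. }
      assert (IH'' : deg_lt (S i) (fun x y => u * r x y + INR (S i) * u ^ 2 * x ^ i * y ^ 0)).
      { apply deg_lt_add; [|apply deg_lt_mono; lia]. apply deg_lt_scal.
        eapply deg_lt_le; [|exact IH]. lia. }
      eapply deg_lt_ext; [|exact (deg_lt_add _ _ _ IH' IH'')].
      intros x y. unfold r. rewrite (S_INR (S i)). replace (S i - 1)%nat with i by lia. simpl. ring.
Qed.

(** Multiply the expansions in $x$ and in $y$: what remains are the terms containing a remainder [r]
    or [s] and the product of the two first-order terms, of degree $i+j-2$. *)
Lemma mono_diff_deg u v i j :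
  deg_lt (i + j - 1) (fun x y => (x + u) ^ i * (y + v) ^ j - x ^ i * y ^ j
    - INR i * u * x ^ (i - 1) * y ^ j - INR j * v * x ^ i * y ^ (j - 1)).
Proof.
  destruct i as [|i].
  { eapply deg_lt_ext; [|apply deg_lt_swap, (pow_shift_deg v j)]. intros; simpl; ring. }
  destruct j as [|j].
  { replace (S i + 0 - 1)%nat with (S i - 1)%nat by lia.
    eapply deg_lt_ext; [|apply (pow_shift_deg u (S i))]. intros; simpl; ring. }
  set (r := fun x (_ : R) => (x + u) ^ S i - x ^ S i - INR (S i) * u * x ^ (S i - 1)).
  set (s := fun (_ : R) y => (y + v) ^ S j - y ^ S j - INR (S j) * v * y ^ (S j - 1)).
  assert (Hr : deg_lt (S i - 1) r) by apply pow_shift_deg.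
  assert (Hs : deg_lt (S j - 1) s) by exact (deg_lt_swap _ _ (pow_shift_deg v (S j))).
  assert (Hx : deg_lt (S (S i)) (fun x _ => x ^ S i + INR (S i) * u * x ^ (S i - 1))).
  { apply deg_lt_add; [|apply deg_lt_scal]; apply deg_lt_xpow; lia. }
  assert (Hy : deg_lt (S (S j)) (fun _ y => y ^ S j + INR (S j) * v * y ^ (S j - 1))).
  { apply (deg_lt_swap _ (fun y _ => y ^ S j + INR (S j) * v * y ^ (S j - 1))).
    apply deg_lt_add; [|apply deg_lt_scal]; apply deg_lt_xpow; lia. }
  assert (Hs' : deg_lt (S (S j)) s) by (eapply deg_lt_le; [|exact Hs]; lia).
  assert (H1 := deg_lt_mult _ _ _ _ Hr (deg_lt_add _ _ _ Hy Hs')).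
  assert (H2 := deg_lt_mult _ _ _ _ Hx Hs).
  assert (H3 : deg_lt (S i + S j - 1) (fun x y => (INR (S i) * u * INR (S j) * v) * x ^ (S i - 1) * y ^ (S j - 1)))
    by (apply deg_lt_mono; lia).
  assert (H1' := deg_lt_le (S i - 1 + S (S j) - 1) (S i + S j - 1) _ ltac:(lia) H1).
  assert (H2' := deg_lt_le (S (S i) + (S j - 1) - 1) (S i + S j - 1) _ ltac:(lia) H2).
  eapply deg_lt_ext; [|exact (deg_lt_add _ _ _ (deg_lt_add _ _ _ H1' H2') H3)].
  intros x y. unfold r, s. ring.
Qed.

Lemma fdiff_deg_lt n F u v : deg_lt (S n) F -> deg_lt n (fdiff u v F).
Proof.
  induction 1 as [|c i j H|F G _ IF _ IG|F G E _ IF].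
  - eapply deg_lt_ext; [|apply deg_lt_zero]. intros; unfold fdiff; ring.
  - assert (H1 := deg_lt_scal _ c _ (mono_diff_deg (IZR u) (IZR v) i j)).
    assert (H1' := deg_lt_le (i + j - 1) n _ ltac:(lia) H1).
    assert (H2 : deg_lt n (fun x y => (c * INR i * IZR u) * x ^ (i - 1) * y ^ j)).
    { destruct i as [|i]; [|apply deg_lt_mono; lia].
      eapply deg_lt_ext; [|apply deg_lt_zero]. intros; simpl; ring. }
    assert (H3 : deg_lt n (fun x y => (c * INR j * IZR v) * x ^ i * y ^ (j - 1))).
    { destruct j as [|j]; [|apply deg_lt_mono; lia].
      eapply deg_lt_ext; [|apply deg_lt_zero]. intros; simpl; ring. }
    eapply deg_lt_ext; [|exact (deg_lt_add _ _ _ H1' (deg_lt_add _ _ _ H2 H3))].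
    intros; unfold fdiff; ring.
  - eapply deg_lt_ext; [|apply deg_lt_add; [exact IF|exact IG]]. intros; unfold fdiff; ring.
  - eapply deg_lt_ext; [|exact IF]. intros; unfold fdiff. now rewrite !E.
Qed.

Definition hom (n : nat) (a : nat -> R) (x y : R) : R :=
  rs (fun i => a i * x ^ i * y ^ (n - i)) (S n).

(** On the leading form a difference acts as the directional derivative $u\partial_x+v\partial_y$;
    [L] collects the higher-order remainders. *)
Lemma hom_fdiff N a u v : exists L, deg_lt N L /\ forall x y,
  fdiff u v (hom (S N) a) x y =
  hom N (fun i => INR (S i) * IZR u * a (S i) + INR (S N - i) * IZR v * a i) x y + L x y.
Proof.
  exists (fun x y => rs (fun i => a i * ((x + IZR u) ^ i * (y + IZR v) ^ (S N - i) - x ^ i * y ^ (S N - i)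
    - INR i * IZR u * x ^ (i - 1) * y ^ (S N - i)
    - INR (S N - i) * IZR v * x ^ i * y ^ (S N - i - 1))) (S (S N))).
  split.
  - apply deg_lt_rs. intros i Hi. apply deg_lt_scal.
    eapply deg_lt_le; [|apply mono_diff_deg]. lia.
  - intros x y.
    set (f1 := fun i => a i * (INR i * IZR u * x ^ (i - 1) * y ^ (S N - i))).
    set (f2 := fun i => a i * (INR (S N - i) * IZR v * x ^ i * y ^ (S N - i - 1))).
    assert (E : hom N (fun i => INR (S i) * IZR u * a (S i) + INR (S N - i) * IZR v * a i) x y
                = rs f1 (S (S N)) + rs f2 (S (S N))).
    (* The $x$-derivatives are shifted by one index to match monomials; the dropped end terms, the
       first of [f1] and the last of [f2], vanish. *)
    { rewrite (rs_head f1). change (rs f2 (S (S N))) with (rs f2 (S N) + f2 (S N)).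
      unfold f1 at 1, f2 at 2. rewrite Nat.sub_diag. simpl (INR 0).
      unfold hom. rewrite (rs_ext _ (fun i => f1 (S i) + f2 i)).
      - rewrite rs_plus. ring.
      - intros i Hi. unfold f1, f2. replace (S N - i - 1)%nat with (N - i)%nat by lia.
        replace (S i - 1)%nat with i by lia. replace (S N - S i)%nat with (N - i)%nat by lia. ring. }
    rewrite E. unfold fdiff, hom, Rminus.
    replace (- rs (fun i => a i * x ^ i * y ^ (S N - i)) (S (S N)))
      with (rs (fun i => (-1) * (a i * x ^ i * y ^ (S N - i))) (S (S N))) by (rewrite rs_scal; ring).
    rewrite <- !rs_plus. apply rs_ext. intros i Hi. unfold f1, f2. ring.
Qed.

(** If two independent steps both gave rational leading coefficients, solving the resulting linear
    system by Cramer's rule, with determinant $uv'-u'v\ne0$, would make every $a_i$ rational. *)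
Lemma hom_irr_phase n a F L : deg_lt (S n) L -> (forall x y, F x y = hom (S n) a x y + L x y) ->
  (exists i, (i <= S n)%nat /\ ~ rational (a i)) -> irr_phase n F.
Proof.
  revert a F L. induction n as [|n IH]; intros a F L HL HF [i0 [Hi0 Hirr]].
  - exists (a 1%nat), (a 0%nat), (L 0 0). split.
    + intros x y. rewrite HF, (deg_lt_1 L HL x y). unfold hom. simpl. ring.
    + intros [H1 H0]. destruct i0 as [|[|i0]]; [contradiction|contradiction|lia].
  - intros u v u' v' Hdet.
    set (D := fun (w z : Z) i => INR (S i) * IZR w * a (S i) + INR (S (S n) - i) * IZR z * a i).
    assert (Hstep : forall w z, (exists i, (i <= S n)%nat /\ ~ rational (D w z i)) ->
              irr_phase n (fdiff w z F)).
    { intros w z Hex. destruct (hom_fdiff (S n) a w z) as [L' [HL' EL']].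
      apply IH with (D w z) (fun x y => L' x y + fdiff w z L x y); [| |exact Hex].
      - apply deg_lt_add; [assumption|now apply fdiff_deg_lt].
      - intros x y. unfold D. rewrite <- Rplus_assoc, <- EL'. unfold fdiff. rewrite !HF. ring. }
    apply NNPP. intros Hno.
    assert (Hrat : forall w z, (w = u /\ z = v) \/ (w = u' /\ z = v') ->
              forall i, (i <= S n)%nat -> rational (D w z i)).
    { intros w z Hwz i Hi. apply NNPP. intros H. apply Hno.
      destruct Hwz as [[-> ->]|[-> ->]]; [left|right]; apply Hstep; eauto. }
    apply Hirr.
    (* The coefficient [a 0] occurs only in [D w z 0], with factor [z], so there [a 1] is
       eliminated; for [a (S i0)] the coefficient [a i0] is eliminated. *)
    destruct i0 as [|i0].
    + assert (H1 := Hrat u v ltac:(auto) 0%nat ltac:(lia)).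
      assert (H2 := Hrat u' v' ltac:(auto) 0%nat ltac:(lia)).
      apply rational_IZR_mult_rev with ((u * v' - u' * v) * Z.of_nat (S (S n)))%Z; [nia|].
      replace (IZR _ * a 0%nat) with (IZR u * D u' v' 0%nat - IZR u' * D u v 0%nat).
      * apply rational_minus; apply rational_mult; auto using rational_IZR.
      * unfold D. rewrite Nat.sub_0_r, mult_IZR, minus_IZR, !mult_IZR, <- INR_IZR_INZ. ring.
    + assert (H1 := Hrat u v ltac:(auto) i0 ltac:(lia)).
      assert (H2 := Hrat u' v' ltac:(auto) i0 ltac:(lia)).
      apply rational_IZR_mult_rev with ((u * v' - u' * v) * Z.of_nat (S i0))%Z; [nia|].
      replace (IZR _ * a (S i0)) with (IZR v' * D u v i0 - IZR v * D u' v' i0).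
      * apply rational_minus; apply rational_mult; auto using rational_IZR.
      * unfold D. rewrite mult_IZR, minus_IZR, !mult_IZR, <- INR_IZR_INZ. ring.
Qed.

(** One difference turns the added linear function into a constant, so the rational slopes matter
    only at level 0, where they preserve irrationality. The constant [c] may be any real. *)
Lemma irr_phase_add_rational n F G alpha beta c : rational alpha -> rational beta ->
  (forall x y, G x y = F x y + (alpha * x + beta * y + c)) -> irr_phase n F -> irr_phase n G.
Proof.
  revert F G alpha beta c. induction n as [|n IH]; intros F G alpha beta c Ha Hb HG HF.
  - destruct HF as [al [be [e [HF Hirr]]]]. exists (al + alpha), (be + beta), (e + c). split.
    + intros. rewrite HG, HF. ring.
    + intros [H1 H2]. apply Hirr. split.
      * replace al with ((al + alpha) - alpha) by ring. now apply rational_minus.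
      * replace be with ((be + beta) - beta) by ring. now apply rational_minus.
  - assert (Hd : forall u v x y, fdiff u v G x y =
        fdiff u v F x y + (IZR 0 * x + IZR 0 * y + (alpha * IZR u + beta * IZR v))).
    { intros. unfold fdiff. rewrite !HG. ring. }
    intros u v u' v' Hdet. destruct (HF u v u' v' Hdet) as [H|H]; [left|right]; revert H;
      (eapply IH; [apply rational_IZR|apply rational_IZR|apply Hd]).
Qed.

(** * Rational coefficients and windows *)

(** Finite linear combinations of characters with rational frequencies. Cancellation passes through
    linear combinations, and a single such character merges with the phase by
    [irr_phase_add_rational]. *)
Inductive char_comb : (nat -> nat -> Complex.C) -> Prop :=
| cc_char alpha beta : rational alpha -> rational beta ->
    char_comb (fun p s => ee (alpha * INR p + beta * INR s))
| cc_scal z f : char_comb f -> char_comb (fun p s => z * f p s)%C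
| cc_add f g : char_comb f -> char_comb g -> char_comb (fun p s => f p s + g p s)%C
| cc_ext f g : (forall p s, f p s = g p s) -> char_comb f -> char_comb g.

Lemma cc_mult f g : char_comb f -> char_comb g -> char_comb (fun p s => f p s * g p s)%C.
Proof.
  intros Hf Hg. induction Hf as [al be Ha Hb|z f Hf IH|f f' Hf IH Hf' IH'|f f' E Hf IH].
  - induction Hg as [al' be' Ha' Hb'|z g Hg IH|g g' Hg IH Hg' IH'|g g' E Hg IH].
    + eapply cc_ext; [|apply (cc_char (al + al') (be + be')); now apply rational_plus].
      intros p s; simpl. rewrite <- ee_plus. f_equal. ring.
    + eapply cc_ext; [|apply (cc_scal z _ IH)]. intros; simpl; ring.
    + eapply cc_ext; [|apply (cc_add _ _ IH IH')]. intros; simpl; ring.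
    + eapply cc_ext; [|exact IH]. intros; simpl. now rewrite E.
  - eapply cc_ext; [|apply (cc_scal z _ IH)]. intros; simpl; ring.
  - eapply cc_ext; [|apply (cc_add _ _ IH IH')]. intros; simpl; ring.
  - eapply cc_ext; [|exact IH]. intros; simpl. now rewrite E.
Qed.

Lemma cc_const z : char_comb (fun _ _ => z).
Proof.
  eapply cc_ext; [|apply (cc_scal z), (cc_char 0 0); apply (rational_IZR 0)].
  intros; simpl. rewrite !Rmult_0_l, Rplus_0_l, ee_0. ring.
Qed.

Lemma cc_csum (f : nat -> nat -> nat -> Complex.C) n : (forall i, (i < n)%nat -> char_comb (f i)) ->
  char_comb (fun p s => csum (fun i => f i p s) n).
Proof.
  induction n as [|n IH]; intros H; simpl; [apply cc_const|].
  apply cc_add; [apply IH; auto|apply H; lia].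
Qed.

Definition residue_indicator (q w p : nat) : Complex.C :=
  (/ RtoC (INR q) * csum (fun u => ee (INR u * (IZR (Z.of_nat p - Z.of_nat w) / INR q))) q)%C.

Lemma residue_indicator_spec q w p : (0 < q)%nat -> (w < q)%nat ->
  residue_indicator q w p = if Nat.eq_dec (p mod q) w then RtoC 1 else RtoC 0.
Proof.
  intros Hq Hw. unfold residue_indicator. rewrite csum_roots_of_unity by assumption.
  assert (Hq' : RtoC (INR q) <> RtoC 0).
  { intros H. apply RtoC_inj in H. revert H. apply not_0_INR. lia. }
  assert (Ep := Nat.div_mod p q ltac:(lia)). assert (Hp := Nat.mod_upper_bound p q ltac:(lia)).
  destruct (Z.eq_dec _ _) as [E|E]; destruct (Nat.eq_dec _ _) as [E'|E'].
  - now apply Cinv_l.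
  - exfalso. apply E'. apply Z.mod_divide in E; [|lia]. destruct E as [y Hy].
    assert (Z.of_nat (p mod q) - Z.of_nat w = (y - Z.of_nat (p / q)) * Z.of_nat q)%Z by nia.
    assert (y - Z.of_nat (p / q) = 0)%Z by nia. nia.
  - exfalso. apply E. apply Z.mod_divide; [lia|]. exists (Z.of_nat (p / q)). nia.
  - ring.
Qed.

Lemma cc_residue1 q w : (0 < q)%nat -> char_comb (fun p _ => residue_indicator q w p).
Proof.
  intros Hq. unfold residue_indicator. apply cc_scal. apply cc_csum. intros u _.
  eapply cc_ext; [|apply (cc_scal (ee (- (INR u * INR w / INR q)))),
                    (cc_char (IZR (Z.of_nat u) / INR q) 0);
                   [now apply rational_quotient|apply (rational_IZR 0)]].
  intros p s; simpl. rewrite <- ee_plus. f_equal. rewrite minus_IZR, <- !INR_IZR_INZ.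
  field. apply not_0_INR. lia.
Qed.

Lemma cc_swap f : char_comb f -> char_comb (fun p s => f s p).
Proof.
  induction 1 as [al be Ha Hb|z f Hf IH|f f' Hf IH Hf' IH'|f f' E Hf IH].
  - eapply cc_ext; [|apply (cc_char be al); assumption]. intros; simpl. f_equal. ring.
  - now apply cc_scal.
  - now apply cc_add.
  - eapply cc_ext; [|exact IH]. intros; simpl. apply E.
Qed.

(** Expand [f] over pairs of residue classes; the indicator of a class is an average of characters
    of order dividing $q$. *)
Lemma cc_periodic q f : (0 < q)%nat -> (forall p s, f p s = f (p mod q)%nat (s mod q)%nat) ->
  char_comb f.
Proof.
  intros Hq Hf.
  apply cc_ext with (fun p s => csum (fun w1 => csum (fun w2 =>
    f w1 w2 * (residue_indicator q w1 p * residue_indicator q w2 s))%C q) q).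
  - intros p s. rewrite (Hf p s).
    assert (Hp := Nat.mod_upper_bound p q ltac:(lia)). assert (Hs := Nat.mod_upper_bound s q ltac:(lia)).
    rewrite (csum_single _ (p mod q)); [|assumption|].
    + rewrite (csum_single _ (s mod q)); [|assumption|].
      * rewrite !residue_indicator_spec by assumption.
        destruct (Nat.eq_dec _ _); [|congruence]. destruct (Nat.eq_dec _ _); [ring|congruence].
      * intros w Hw Hne. rewrite (residue_indicator_spec q w s) by assumption.
        destruct (Nat.eq_dec _ _); [congruence|ring].
    + intros w Hw Hne. rewrite (csum_ext _ (fun _ => RtoC 0)), csum_const; [ring|].
      intros w' Hw'. rewrite (residue_indicator_spec q w p) by assumption.
      destruct (Nat.eq_dec _ _); [congruence|ring].
  - apply cc_csum. intros w1 _. apply cc_csum. intros w2 _. apply cc_scal.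
    apply cc_mult; [now apply cc_residue1|].
    exact (cc_swap _ (cc_residue1 q w2 Hq)).
Qed.

Lemma pow_mod_eq p q i : ((p ^ i) mod q = ((p mod q) ^ i) mod q)%nat.
Proof.
  induction i as [|i IH]; [reflexivity|].
  rewrite !Nat.pow_succ_r', (Nat.Div0.mul_mod p), IH.
  apply Nat.Div0.mul_mod_idemp_r.
Qed.

Lemma ee_fraction_mod z q n : (0 < q)%nat ->
  ee (IZR z / INR q * INR n) = ee (IZR z / INR q * INR (n mod q)).
Proof.
  intros Hq. rewrite (Nat.div_mod n q) at 1 by lia.
  rewrite plus_INR, mult_INR.
  replace (_ * _) with (IZR z / INR q * INR (n mod q) + IZR (z * Z.of_nat (n / q))).
  - apply ee_add_IZR.
  - rewrite mult_IZR, <- INR_IZR_INZ. field. apply not_0_INR. lia.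
Qed.

(** If $q$ is a denominator of $c$, the value depends only on $p$ and $s$ modulo $q$. *)
Lemma cc_monomial c i j : rational c -> char_comb (fun p s => ee (c * INR p ^ i * INR s ^ j)).
Proof.
  intros Hc. destruct (rational_fraction c Hc) as [z [q [Hq ->]]].
  apply (cc_periodic q); [assumption|]. intros p s.
  rewrite !Rmult_assoc, <- !pow_INR, <- !mult_INR.
  rewrite ee_fraction_mod by assumption. rewrite (ee_fraction_mod z q (_ ^ i * _)) by assumption.
  do 3 f_equal. rewrite (Nat.Div0.mul_mod (p ^ i)), (pow_mod_eq p), (pow_mod_eq s).
  now rewrite <- Nat.Div0.mul_mod.
Qed.

Lemma cc_ee_rs (f : nat -> nat -> nat -> R) n :
  (forall i, (i < n)%nat -> char_comb (fun p s => ee (f i p s))) ->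
  char_comb (fun p s => ee (rs (fun i => f i p s) n)).
Proof.
  induction n as [|n IH]; intros H; simpl.
  - apply cc_const.
  - eapply cc_ext; [|apply cc_mult; [apply IH; auto|apply (H n); lia]].
    intros; simpl. now rewrite ee_plus.
Qed.

(** * Splitting a polynomial at the top degree of its irrational coefficients *)

Lemma sum_f_R0_rs f n : sum_f_R0 f n = rs f (S n).
Proof. induction n as [|n IH]; simpl; [ring|]. now rewrite IH. Qed.

Lemma poly2_rs d c x y : poly2 d c x y = rs (fun i => rs (fun j => c i j * x ^ i * y ^ j) (S d)) (S d).
Proof.
  unfold poly2. rewrite sum_f_R0_rs. apply rs_ext. intros. apply sum_f_R0_rs.
Qed.

(** The coefficient array is square, so on an antidiagonal $i+j=t$ positions outside the array get
    the value 0. *)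
Definition hom_coef (d : nat) (c : nat -> nat -> R) (t i : nat) : R :=
  if le_dec i d then if le_dec (t - i) d then c i (t - i)%nat else 0 else 0.

Lemma homogeneous_part d c t x y :
  rs (fun i => rs (fun j => if Nat.eq_dec (i + j) t then c i j * x ^ i * y ^ j else 0) (S d)) (S d)
  = hom t (hom_coef d c t) x y.
Proof.
  set (h := fun i => if le_dec i t then hom_coef d c t i * x ^ i * y ^ (t - i) else 0).
  (* The summation ranges up to [d] and up to [t] are compared through a common longer one, on whose
     excess [h] vanishes. *)
  transitivity (rs h (S (max d t))); [symmetry; rewrite (rs_vanish h (S d))|rewrite (rs_vanish h (S t))].
  - apply rs_ext. intros i Hi. unfold h, hom_coef. destruct (le_dec i d); [|lia].
    destruct (le_dec i t).
    + destruct (le_dec (t - i) d).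
      * rewrite (rs_single _ (t - i)%nat) by
          (try lia; intros; (destruct (Nat.eq_dec _ _); [lia|reflexivity])).
        destruct (Nat.eq_dec _ _); [reflexivity|lia].
      * rewrite (rs_ext _ (fun _ => 0)), rs_const; [ring|].
        intros; destruct (Nat.eq_dec _ _); [lia|reflexivity].
    + rewrite (rs_ext _ (fun _ => 0)), rs_const; [ring|].
      intros; destruct (Nat.eq_dec _ _); [lia|reflexivity].
  - lia.
  - intros i Hi _. unfold h, hom_coef. destruct (le_dec i t); [|reflexivity].
    destruct (le_dec i d); [lia|ring].
  - apply rs_ext. intros i Hi. unfold h. destruct (le_dec i t); [reflexivity|lia].
  - lia.
  - intros i Hi _. unfold h. destruct (le_dec i t); [lia|reflexivity].
Qed.

Lemma max_satisfying (P : nat -> Prop) n t0 : (forall t, P t -> (t <= n)%nat) -> P t0 ->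
  exists t, P t /\ (t0 <= t)%nat /\ forall t', P t' -> (t' <= t)%nat.
Proof.
  intros Hn. remember (n - t0)%nat as k eqn:Ek. revert t0 Ek.
  induction k as [k IH] using lt_wf_ind. intros t0 Ek H0.
  destruct (classic (exists t', P t' /\ (t0 < t')%nat)) as [[t' [H1 H2]]|Hno].
  - assert (t' <= n)%nat by auto.
    destruct (IH (n - t')%nat ltac:(lia) t' eq_refl H1) as [t [Ht [Ht' Ht'']]].
    exists t. split; [exact Ht|]. split; [lia|exact Ht''].
  - exists t0. split; [exact H0|]. split; [lia|]. intros t' Ht'.
    destruct (le_lt_dec t' t0); [assumption|]. exfalso. eauto.
Qed.

(** Let $t$ be the largest total degree carrying an irrational coefficient. The part of degree at
    most $t$ goes into [F]; all monomials above are rational and go into [g]. *)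
Lemma poly2_decomposition d c : has_irrational_nonconst_coef d c ->
  exists n F g, irr_phase n F /\ char_comb g /\
    forall p s : nat, ee (poly2 d c (INR p) (INR s)) = (ee (F (INR p) (INR s)) * g p s)%C.
Proof.
  intros [i0 [j0 [Hi0 [Hj0 [Hij0 Hirr0]]]]].
  set (P := fun t => exists i j, (i <= d)%nat /\ (j <= d)%nat /\ (i + j = t)%nat /\ ~ rational (c i j)).
  destruct (max_satisfying P (2 * d) (i0 + j0)) as [t [[i1 [j1 [Hi1 [Hj1 [Et Hirr1]]]]] [Ht0 Hmax]]].
  - intros t [i [j [Hi [Hj [E _]]]]]. lia.
  - exists i0, j0. repeat split; assumption.
  (* The given irrational coefficient is non-constant, so $t\ge i_0+j_0\ge1$. *)
  - destruct t as [|n]; [lia|]. set (t := S n) in *.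
    set (low := fun x y => rs (fun i => rs (fun j =>
      (if lt_dec (i + j) t then c i j else 0) * x ^ i * y ^ j) (S d)) (S d)).
    exists n, (fun x y => hom t (hom_coef d c t) x y + low x y),
      (fun p s => ee (rs (fun i => rs (fun j =>
         (if le_dec (i + j) t then 0 else c i j) * INR p ^ i * INR s ^ j) (S d)) (S d))).
    split; [|split].
    + apply (hom_irr_phase n (hom_coef d c t) _ low).
      * apply deg_lt_rs. intros i Hi. apply deg_lt_rs. intros j Hj.
        destruct (lt_dec (i + j) t); [now apply deg_lt_mono|].
        eapply deg_lt_ext; [|apply deg_lt_zero]. intros; simpl; ring.
      * reflexivity.
      * exists i1. split; [fold t; lia|]. unfold hom_coef.
        destruct (le_dec i1 d); [|contradiction].
        replace (t - i1)%nat with j1 by lia. destruct (le_dec j1 d); [assumption|contradiction].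
    + apply cc_ee_rs. intros i Hi. apply cc_ee_rs. intros j Hj.
      apply cc_monomial. destruct (le_dec (i + j) t) as [H|H]; [apply (rational_IZR 0)|].
      apply NNPP. intros Hn. apply H. apply Hmax. exists i, j. repeat split; auto; lia.
    + intros p s. rewrite <- ee_plus. f_equal. rewrite <- homogeneous_part, poly2_rs.
      unfold low. rewrite <- !rs_plus. apply rs_ext. intros i _. rewrite <- !rs_plus.
      apply rs_ext. intros j _.
      destruct (Nat.eq_dec (i + j) t); destruct (lt_dec (i + j) t); destruct (le_dec (i + j) t);
        try lia; ring.
Qed.

(** * From aligned blocks to arbitrary windows *)

Section Windows.
Context (f : nat -> Complex.C) (L : nat) (eps : R) (HL : (0 < L)%nat) (Heps : 0 <= eps)
  (Hf : forall n, Cmod (f n) <= 1)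
  (Hblock : forall q, Cmod (csum (fun r => f (q * L + r)%nat) L) <= eps * INR L).

Lemma aligned_window_sum len : forall q,
  Cmod (csum (fun i => f (q * L + i)%nat) len) <= eps * INR len + INR L.
Proof.
  induction len as [len IH] using lt_wf_ind. intros q.
  destruct (le_lt_dec L len) as [H|H].
  - replace len with (L + (len - L))%nat by lia. rewrite csum_add.
    eapply Rle_trans; [apply Cmod_triangle|].
    rewrite (csum_ext (fun i => f (q * L + (L + i))%nat) (fun i => f (S q * L + i)%nat))
      by (intros; f_equal; simpl; lia).
    specialize (IH (len - L)%nat ltac:(lia) (S q)). specialize (Hblock q).
    rewrite plus_INR. lra.
  - apply Rle_trans with (INR len * 1); [apply Cmod_csum_le; auto|].
    assert (INR len <= INR L) by (apply le_INR; lia).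
    assert (0 <= INR len) by apply pos_INR. nra.
Qed.

(** The window is an aligned one, starting at a multiple of $L$, minus an initial piece shorter than
    $L$. *)
Lemma window_sum M len :
  Cmod (csum (fun i => f (M + i)%nat) len) <= eps * INR len + (eps + 2) * INR L.
Proof.
  assert (E := Nat.div_mod M L ltac:(lia)). assert (Hr := Nat.mod_upper_bound M L ltac:(lia)).
  set (q := (M / L)%nat) in *. set (r := (M mod L)%nat) in *.
  assert (Es := csum_add (fun i => f (q * L + i)%nat) r len).
  rewrite (csum_ext (fun i => f (q * L + (r + i))%nat) (fun i => f (M + i)%nat)) in Es
    by (intros; f_equal; lia).
  assert (Es' : csum (fun i => f (M + i)%nat) len =
    (csum (fun i => f (q * L + i)%nat) (r + len) + - csum (fun i => f (q * L + i)%nat) r)%C)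
    by (rewrite Es; ring).
  rewrite Es'. eapply Rle_trans; [apply Cmod_triangle|]. rewrite Cmod_opp.
  assert (H1 := aligned_window_sum (r + len) q).
  assert (H2 : Cmod (csum (fun i => f (q * L + i)%nat) r) <= INR r * 1) by (apply Cmod_csum_le; auto).
  rewrite plus_INR in H1. assert (INR r <= INR L) by (apply le_INR; lia). nra.
Qed.
End Windows.

Lemma rsum_from_rs f M n : rsum_from f M n = rs (fun i => f (M + S i)%nat) n.
Proof. induction n as [|n IH]; simpl; [reflexivity|]. now rewrite IH. Qed.

Lemma exp_avg_mod_csum g M N : (M < N)%nat ->
  exp_avg_mod g M N = Cmod (csum (fun i => ee (g (M + S i)%nat)) (N - M)) / INR (N - M).
Proof.
  intros H. assert (HN : 0 < INR (N - M)) by (apply lt_0_INR; lia).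
  unfold exp_avg_mod, rsum. rewrite !rsum_from_rs.
  set (z := csum _ _).
  assert (Hre : rs (fun i => e_re (g (M + S i)%nat)) (N - M) = Re z)
    by (unfold z; now rewrite Re_csum).
  assert (Him : rs (fun i => e_im (g (M + S i)%nat)) (N - M) = Im z)
    by (unfold z; now rewrite Im_csum).
  rewrite Hre, Him.
  rewrite <- (Rabs_pos_eq (Cmod z / INR (N - M))) by
    (apply Rmult_le_pos; [apply Cmod_ge_0|left; now apply Rinv_0_lt_compat]).
  rewrite <- sqrt_Rsqr_abs. f_equal. unfold Rsqr.
  assert (E := Cmod2_alt z).
  replace (Cmod z / INR (N - M) * (Cmod z / INR (N - M)))
    with (Cmod z ^ 2 / INR (N - M) ^ 2) by (field; lra).
  rewrite E. field. lra.
Qed.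

(** * Averages along the enumeration *)

Section Enumeration.
Context (b B : nat) (delta : nat -> nat) (Hb : (2 <= b)%nat) (HB : (2 <= B)%nat)
  (delta0 : delta 0%nat = 0%nat) (delta1 : (1 <= delta 1)%nat).

(** Translations are natural numbers here because the periodic factor is defined on naturals only;
    block offsets are of this kind. *)
Let cancellingN (f : nat -> nat -> Complex.C) : Prop :=
  forall eps, 0 < eps -> exists K0, forall K, (K0 <= K)%nat -> forall p s : nat,
    Cmod (csum (fun r => f (digmap b B delta r + p)%nat (digmap 1 B delta r + s)%nat) (B ^ K))
    <= eps * INR (B ^ K).

Lemma char_comb_cancelling gamma n F g : ~ rational gamma -> irr_phase n F -> char_comb g ->
  cancellingN (fun p s => ee (F (INR p) (INR s)) * g p s)%C.
Proof.
  intros Hg HF Hc.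
  induction Hc as [al be Ha Hbe|z f Hf IH|f f' Hf IH Hf' IH'|f f' E Hf IH]; intros eps Heps.
  - assert (HG : irr_phase n (fun x y => F x y + (al * x + be * y + 0)))
      by (eapply irr_phase_add_rational; [exact Ha|exact Hbe| |exact HF]; reflexivity).
    destruct (irr_phase_cancelling b B delta Hb HB delta0 delta1 gamma n _ Hg HG eps Heps) as [K0 HK0].
    exists K0. intros K HK p s. specialize (HK0 K HK (INR p) (INR s)).
    eapply Rle_trans; [|exact HK0]. right. f_equal. apply csum_ext. intros r _.
    rewrite <- !plus_INR, <- ee_plus. f_equal. ring.
  - destruct (IH (eps / (Cmod z + 1))) as [K0 HK0].
    { apply Rdiv_lt_0_compat; [assumption|]. assert (H := Cmod_ge_0 z). lra. }
    exists K0. intros K HK p s. specialize (HK0 K HK p s).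
    rewrite (csum_ext _ (fun r => z * (ee (F (INR (digmap b B delta r + p)) (INR (digmap 1 B delta r + s)))
       * f (digmap b B delta r + p)%nat (digmap 1 B delta r + s)%nat))%C) by (intros; ring).
    rewrite csum_scal, Cmod_mult.
    set (w := Cmod (csum _ _)) in *. set (L := INR (B ^ K)) in *.
    assert (Hz := Cmod_ge_0 z). assert (0 <= w) by apply Cmod_ge_0.
    apply Rle_trans with ((Cmod z + 1) * (eps / (Cmod z + 1) * L)); [|right; field; lra].
    apply Rmult_le_compat; lra.
  - destruct (IH (eps / 2)) as [K1 HK1]; [lra|]. destruct (IH' (eps / 2)) as [K2 HK2]; [lra|].
    exists (max K1 K2). intros K HK p s.
    specialize (HK1 K ltac:(lia) p s). specialize (HK2 K ltac:(lia) p s).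
    rewrite (csum_ext _ _ _ (fun r _ => Cmult_plus_distr_l _ _ _)), csum_plus.
    eapply Rle_trans; [apply Cmod_triangle|]. lra.
  - destruct (IH eps Heps) as [K0 HK0]. exists K0. intros K HK p s.
    rewrite (csum_ext _ _ _ (fun r _ => f_equal _ (eq_sym (E _ _)))). now apply HK0.
Qed.

Lemma digmap_poly2_avg (k : nat -> nat) d c :
  (forall n, k (S n) = digmap b B delta n) ->
  (forall n, sdig b (digmap b B delta n) = digmap 1 B delta n) ->
  has_irrational_nonconst_coef d c ->
  avg_tends_to_0 (fun n => poly2 d c (INR (k n)) (INR (sdig b (k n)))).
Proof.
  intros Hk Hs Hirr eta Heta.
  assert (Hgam : exists gamma, ~ rational gamma).
  { destruct Hirr as [i [j [_ [_ [_ H]]]]]. exists (c i j). exact H. }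
  destruct Hgam as [gamma Hgam].
  destruct (poly2_decomposition d c Hirr) as [n [F [g [HF [Hcc Hdec]]]]].
  destruct (char_comb_cancelling gamma n F g Hgam HF Hcc (eta / 2)) as [K HK]; [lra|].
  specialize (HK K (le_n K)).
  set (f := fun m => ee (poly2 d c (INR (digmap b B delta m)) (INR (digmap 1 B delta m)))).
  assert (HBK : (0 < B ^ K)%nat) by (apply Nat.neq_0_lt_0, Nat.pow_nonzero; lia).
  assert (Hblock : forall q, Cmod (csum (fun r => f (q * B ^ K + r)%nat) (B ^ K)) <= eta / 2 * INR (B ^ K)).
  { intros q. specialize (HK (b ^ K * digmap b B delta q)%nat (digmap 1 B delta q)).
    eapply Rle_trans; [|exact HK]. right. f_equal. apply csum_ext. intros r Hr.
    unfold f. rewrite !(digmap_block B delta HB delta0) by assumption. rewrite Hdec.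
    rewrite Nat.pow_1_l, Nat.mul_1_l, !(Nat.add_comm (digmap _ _ _ r)). reflexivity. }
  assert (Hf : forall m, Cmod (f m) <= 1) by (intros; unfold f; rewrite Cmod_ee; lra).
  set (L := (B ^ K)%nat) in *.
  (* From length [L0] on, the boundary term of [window_sum] is below the remaining half of [eta]. *)
  destruct (INR_unbounded ((eta / 2 + 2) * INR L / (eta / 2))) as [L0 HL0].
  exists L0. intros M N HMN HL. rewrite exp_avg_mod_csum by assumption.
  assert (HN : 0 < INR (N - M)) by (apply lt_0_INR; lia).
  rewrite (csum_ext _ (fun i => f (M + i)%nat)).
  - assert (H := window_sum f L (eta / 2) HBK ltac:(lra) Hf Hblock M (N - M)).
    assert (HL' : INR L0 <= INR (N - M)) by now apply le_INR.
    apply Rmult_lt_reg_r with (INR (N - M)); [assumption|].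
    replace (_ / INR (N - M) * INR (N - M)) with (Cmod (csum (fun i => f (M + i)%nat) (N - M)))
      by (field; lra).
    assert (H3 : (eta / 2 + 2) * INR L < eta / 2 * INR (N - M)).
    { replace ((eta / 2 + 2) * INR L) with (eta / 2 * ((eta / 2 + 2) * INR L / (eta / 2))) by (field; lra).
      apply Rmult_lt_compat_l; lra. }
    lra.
  - intros i _. unfold f. rewrite Nat.add_succ_r, Hk, Hs. reflexivity.
Qed.
End Enumeration.

(** * Weyl's criterion *)

Definition has_mean (g : nat -> Complex.C) (mu : Complex.C) : Prop :=
  forall eps, 0 < eps -> exists N0, forall N, (N0 <= N)%nat ->
    Cmod (csum (fun i => g (S i)) N - INR N * mu) <= eps * INR N.

Lemma has_mean_ext f g mu : (forall n, f n = g n) -> has_mean f mu -> has_mean g mu.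
Proof.
  intros E H eps He. destruct (H eps He) as [N0 HN0]. exists N0. intros N HN.
  rewrite <- (csum_ext (fun i => f (S i))) by auto. now apply HN0.
Qed.

Lemma has_mean_plus f g mu nu : has_mean f mu -> has_mean g nu ->
  has_mean (fun n => f n + g n)%C (mu + nu)%C.
Proof.
  intros Hf Hg eps He.
  destruct (Hf (eps / 2)) as [N1 H1]; [lra|]. destruct (Hg (eps / 2)) as [N2 H2]; [lra|].
  exists (max N1 N2). intros N HN. specialize (H1 N ltac:(lia)). specialize (H2 N ltac:(lia)).
  rewrite csum_plus.
  match type of H1 with Cmod ?u <= _ => match type of H2 with Cmod ?v <= _ =>
    match goal with |- Cmod ?w <= _ => replace w with (u + v)%C by ring end end end.
  eapply Rle_trans; [apply Cmod_triangle|]. lra.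
Qed.

Lemma has_mean_scal z f mu : has_mean f mu -> has_mean (fun n => z * f n)%C (z * mu)%C.
Proof.
  intros Hf eps He. assert (Hz := Cmod_ge_0 z).
  destruct (Hf (eps / (Cmod z + 1))) as [N0 H]; [apply Rdiv_lt_0_compat; lra|].
  exists N0. intros N HN. specialize (H N HN). rewrite csum_scal.
  match type of H with Cmod ?u <= _ =>
    match goal with |- Cmod ?w <= _ => replace w with (z * u)%C by ring end end.
  rewrite Cmod_mult.
  apply Rle_trans with ((Cmod z + 1) * (eps / (Cmod z + 1) * INR N)); [|right; field; lra].
  apply Rmult_le_compat; try apply Cmod_ge_0; [lra|assumption].
Qed.

Lemma has_mean_1 : has_mean (fun _ => RtoC 1) 1.
Proof.
  intros eps He. exists 0%nat. intros N _. rewrite csum_const.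
  replace (_ - _)%C with (RtoC 0) by ring. rewrite Cmod_0.
  apply Rmult_le_pos; [lra|apply pos_INR].
Qed.

Lemma has_mean_avg g : avg_tends_to_0 g -> has_mean (fun n => ee (g n)) 0.
Proof.
  intros H eps He. destruct (H eps He) as [L HL]. exists (S L). intros N HN.
  specialize (HL 0%nat N ltac:(lia) ltac:(lia)).
  rewrite exp_avg_mod_csum in HL by lia. rewrite Nat.sub_0_r in HL.
  assert (HN' : 0 < INR N) by (apply lt_0_INR; lia).
  replace (_ - _)%C with (csum (fun i => ee (g (0 + S i)%nat)) N) by (simpl; ring).
  apply Rmult_le_reg_r with (/ INR N); [now apply Rinv_0_lt_compat|].
  rewrite Rmult_assoc, Rinv_r, Rmult_1_r by lra. lra.
Qed.

(* Trigonometric polynomials on the circle, with their constant term. *)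
Inductive trig : (R -> Complex.C) -> Complex.C -> Prop :=
| trig_char (r : Z) : trig (fun x => ee (IZR r * x)) (if Z.eq_dec r 0 then RtoC 1 else RtoC 0)
| trig_scal z f mu : trig f mu -> trig (fun x => z * f x)%C (z * mu)%C
| trig_add f g mu nu : trig f mu -> trig g nu -> trig (fun x => f x + g x)%C (mu + nu)%C
| trig_ext f g mu : (forall x, f x = g x) -> trig f mu -> trig g mu.

Lemma trig_zero : trig (fun _ => RtoC 0) 0.
Proof.
  assert (H := trig_scal 0 _ _ (trig_char 0)). rewrite Cmult_0_l in H.
  eapply trig_ext; [|exact H]. intros; simpl; ring.
Qed.

Lemma trig_csum (f : nat -> R -> Complex.C) mu n : (forall i, (i < n)%nat -> trig (f i) (mu i)) ->
  trig (fun x => csum (fun i => f i x) n) (csum mu n).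
Proof.
  induction n as [|n IH]; intros H; simpl; [apply trig_zero|].
  apply trig_add; [apply IH; auto|apply H; lia].
Qed.

(** By bilinearity it suffices to take characters $e(rx)$ and $e(sy)$, whose product has mean 1 for
    $r=s=0$ and mean 0 otherwise. *)
Lemma trig_mult_mean (x y : nat -> R) f g mu nu :
  (forall m1 m2 : Z, ~ (m1 = 0%Z /\ m2 = 0%Z) ->
     avg_tends_to_0 (fun n => IZR m1 * x n + IZR m2 * y n)) ->
  trig f mu -> trig g nu -> has_mean (fun n => f (x n) * g (y n))%C (mu * nu)%C.
Proof.
  intros Hxy Hf Hg. induction Hf as [r|z f mu Hf IH|f f' mu mu' Hf IH Hf' IH'|f f' mu E Hf IH].
  - induction Hg as [s|z g nu Hg IH|g g' nu nu' Hg IH Hg' IH'|g g' nu E Hg IH].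
    + apply has_mean_ext with (fun n => ee (IZR r * x n + IZR s * y n));
        [intros; apply ee_plus|].
      destruct (Z.eq_dec r 0) as [Er|Er]; [destruct (Z.eq_dec s 0) as [Es|Es]|].
      * subst. rewrite Cmult_1_r. eapply has_mean_ext; [|apply has_mean_1].
        intros; simpl. rewrite !Rmult_0_l, Rplus_0_l. symmetry. apply ee_0.
      * rewrite Cmult_0_r. apply has_mean_avg, Hxy. tauto.
      * rewrite Cmult_0_l. apply has_mean_avg, Hxy. tauto.
    + rewrite Cmult_assoc, (Cmult_comm _ z), <- Cmult_assoc.
      eapply has_mean_ext; [|apply (has_mean_scal z _ _ IH)]. intros; simpl; ring.
    + rewrite Cmult_plus_distr_l.
      eapply has_mean_ext; [|apply (has_mean_plus _ _ _ _ IH IH')]. intros; simpl; ring.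
    + eapply has_mean_ext; [|exact IH]. intros; simpl. now rewrite E.
  - rewrite <- Cmult_assoc.
    eapply has_mean_ext; [|apply (has_mean_scal z _ _ IH)]. intros; simpl; ring.
  - rewrite Cmult_plus_distr_r.
    eapply has_mean_ext; [|apply (has_mean_plus _ _ _ _ IH IH')]. intros; simpl; ring.
  - eapply has_mean_ext; [|exact IH]. intros; simpl. now rewrite E.
Qed.

(** * Fejer kernels on a grid *)

Definition dirichlet (m : nat) (x : R) : Complex.C := csum (fun r => ee (INR r * x)) m.

(* A sum of Fejer kernels centred at the points [l / m] with [sel l]; over all [l < m] they
   add up to 1 exactly. *)
Definition fejer_sum (sel : nat -> bool) (m : nat) (x : R) : R :=
  / INR m ^ 2 * rs (fun l => if sel l then Cmod (dirichlet m (x - INR l / INR m)) ^ 2 else 0) m.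

Lemma dirichlet2 m x :
  RtoC (Cmod (dirichlet m x) ^ 2) =
  csum (fun r => csum (fun r' => ee (IZR (Z.of_nat r - Z.of_nat r') * x)) m) m.
Proof.
  unfold dirichlet. rewrite Cmod2_csum. apply csum_ext. intros r _. apply csum_ext. intros r' _.
  rewrite <- ee_minus. f_equal. rewrite minus_IZR, <- !INR_IZR_INZ. ring.
Qed.

Lemma csum_diagonal m : csum (fun r => csum (fun r' =>
  if Z.eq_dec (Z.of_nat r - Z.of_nat r') 0 then RtoC 1 else RtoC 0) m) m = RtoC (INR m).
Proof.
  rewrite (csum_ext _ (fun _ => RtoC 1)), csum_const; [ring|]. intros r Hr.
  rewrite (csum_single _ r m Hr).
  - destruct (Z.eq_dec _ _); [reflexivity|lia].
  - intros i _ Hi. destruct (Z.eq_dec _ _); [lia|reflexivity].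
Qed.

(** Summing over the grid kills the terms with $r\ne r'$, since $0<|r-r'|<m$; each of the $m$
    diagonal terms gives $m$. *)
Lemma dirichlet2_total m x : (0 < m)%nat ->
  rs (fun l => Cmod (dirichlet m (x - INR l / INR m)) ^ 2) m = INR m ^ 2.
Proof.
  intros Hm. assert (Hm' : INR m <> 0) by (apply not_0_INR; lia).
  apply RtoC_inj. rewrite <- csum_RtoC.
  rewrite (csum_ext _ _ m (fun l _ => dirichlet2 m (x - INR l / INR m))).
  rewrite csum_exch.
  rewrite (csum_ext _ (fun r => RtoC (INR m) * csum (fun r' =>
     if Z.eq_dec (Z.of_nat r - Z.of_nat r') 0 then RtoC 1 else RtoC 0) m)%C).
  - rewrite csum_scal, csum_diagonal. simpl. rewrite !RtoC_mult. ring.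
  - intros r Hr. rewrite csum_exch, <- csum_scal. apply csum_ext. intros r' Hr'.
    rewrite (csum_ext _ (fun l => ee (IZR (Z.of_nat r - Z.of_nat r') * x) *
       ee (INR l * (IZR (Z.of_nat r' - Z.of_nat r) / INR m)))%C).
    + rewrite csum_scal, csum_roots_of_unity by assumption.
      destruct (Z.eq_dec (Z.of_nat r - Z.of_nat r') 0) as [E|E].
      * replace (Z.of_nat r' - Z.of_nat r)%Z with 0%Z by lia.
        rewrite E, Rmult_0_l, ee_0. simpl. ring.
      * destruct (Z.eq_dec _ _) as [E'|E']; [|ring].
        exfalso. apply Z.mod_divide in E'; [|lia]. destruct E' as [w Hw].
        assert (w = 0)%Z by nia. subst. lia.
    + intros l _. rewrite <- ee_plus. f_equal. rewrite !minus_IZR. field. assumption.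
Qed.

Lemma fejer_sum_bounds sel m x : (0 < m)%nat -> 0 <= fejer_sum sel m x <= 1.
Proof.
  intros Hm. assert (Hm' : 0 < INR m) by now apply lt_0_INR.
  assert (Hi : 0 < / INR m ^ 2) by (apply Rinv_0_lt_compat; nra).
  unfold fejer_sum. split.
  - apply Rmult_le_pos; [lra|]. apply rs_ge0. intros l _.
    destruct (sel l); [apply pow2_ge_0|lra].
  - rewrite <- (Rinv_l (INR m ^ 2)) by nra. apply Rmult_le_compat_l; [lra|].
    rewrite <- (dirichlet2_total m x Hm). apply rs_le. intros l _.
    destruct (sel l); [lra|apply pow2_ge_0].
Qed.

Definition grid_count (sel : nat -> bool) (m : nat) : R := rs (fun l => if sel l then 1 else 0) m.

(** Only the diagonal $r=r'$ feeds the constant term, so each selected kernel has mean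
    $m/m^2=1/m$. *)
Lemma fejer_sum_trig sel m : (0 < m)%nat ->
  trig (fun x => RtoC (fejer_sum sel m x)) (RtoC (grid_count sel m / INR m)).
Proof.
  intros Hm. assert (Hm' : INR m <> 0) by (apply not_0_INR; lia).
  replace (RtoC (grid_count sel m / INR m)) with
    (RtoC (/ INR m ^ 2) * csum (fun l => if sel l then RtoC (INR m) else RtoC 0) m)%C.
  - eapply trig_ext; [|apply trig_scal, (trig_csum (fun l x => if sel l then
      RtoC (Cmod (dirichlet m (x - INR l / INR m)) ^ 2) else RtoC 0))].
    + intros x. unfold fejer_sum. rewrite RtoC_mult, <- csum_RtoC. f_equal.
      apply csum_ext. intros l _. now destruct (sel l).
    + intros l _. destruct (sel l); [|apply trig_zero].
      eapply trig_ext; [intros x; symmetry; apply dirichlet2|].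
      rewrite <- csum_diagonal. apply trig_csum. intros r _. apply trig_csum. intros r' _.
      set (z := (Z.of_nat r - Z.of_nat r')%Z).
      replace (if Z.eq_dec z 0 then RtoC 1 else RtoC 0) with
        (ee (- (IZR z * (INR l / INR m))) * if Z.eq_dec z 0 then RtoC 1 else RtoC 0)%C.
      * eapply trig_ext; [|apply trig_scal, trig_char]. intros x; simpl.
        rewrite <- ee_plus. f_equal. ring.
      * destruct (Z.eq_dec z 0) as [->|_]; [|ring]. rewrite Rmult_0_l, Ropp_0, ee_0. ring.
  - rewrite (csum_ext _ (fun l => RtoC (INR m * if sel l then 1 else 0))).
    + rewrite csum_RtoC, rs_scal, <- RtoC_mult. f_equal. unfold grid_count. field. assumption.
    + intros l _. destruct (sel l); f_equal; ring.
Qed.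

(** From $|D(t)|\,|e(t)-1|\le2$ each selected squared kernel is at most $4/e$; at most $m$ of them
    are summed and divided by $m^2$. *)
Lemma fejer_sum_small sel m x e : (0 < m)%nat -> 0 < e ->
  (forall l, (l < m)%nat -> sel l = true -> e <= Cmod (ee (x - INR l / INR m) - 1) ^ 2) ->
  fejer_sum sel m x <= 4 / (INR m * e).
Proof.
  intros Hm He H. assert (Hm' : 0 < INR m) by now apply lt_0_INR.
  assert (Hi : 0 < / INR m ^ 2) by (apply Rinv_0_lt_compat; nra).
  unfold fejer_sum.
  apply Rle_trans with (/ INR m ^ 2 * (INR m * (4 / e))); [|right; field; lra].
  apply Rmult_le_compat_l; [lra|]. apply rs_le_const. intros l Hl.
  assert (H4 : 0 <= 4 / e) by (left; apply Rdiv_lt_0_compat; lra).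
  specialize (H l Hl). destruct (sel l); [|assumption]. specialize (H eq_refl).
  set (t := x - INR l / INR m) in *.
  assert (Hd : dirichlet m t = csum (fun r => ee t ^ r)%C m)
    by (apply csum_ext; intros; apply ee_INR).
  assert (Ht := geom_telescope (ee t) m). rewrite <- Hd in Ht.
  apply (f_equal Cmod) in Ht. rewrite Cmod_mult in Ht.
  assert (Hle : Cmod (ee t ^ m - 1) <= 2).
  { unfold Cminus. eapply Rle_trans; [apply Cmod_triangle|].
    rewrite Cmod_ee_pow, Cmod_opp, Cmod_1. lra. }
  set (u := Cmod (dirichlet m t)) in *. set (v := Cmod (ee t - 1)) in *.
  assert (0 <= u) by apply Cmod_ge_0. assert (0 <= v) by apply Cmod_ge_0.
  assert (0 <= u * v) by now apply Rmult_le_pos.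
  apply Rmult_le_reg_r with e; [assumption|]. replace (4 / e * e) with 4 by (field; lra).
  assert (u ^ 2 * e <= u ^ 2 * v ^ 2) by (apply Rmult_le_compat_l; [apply pow2_ge_0|assumption]).
  replace (u ^ 2 * v ^ 2) with ((u * v) ^ 2) in * by ring. nra.
Qed.

Lemma fejer_sum_add_IZR sel m x (z : Z) : fejer_sum sel m (x + IZR z) = fejer_sum sel m x.
Proof.
  unfold fejer_sum. f_equal. apply rs_ext. intros l _. destruct (sel l); [|reflexivity].
  do 2 f_equal. apply csum_ext. intros r _.
  replace (INR r * (x + IZR z - INR l / INR m)) with
    (INR r * (x - INR l / INR m) + IZR (Z.of_nat r * z)) by (rewrite mult_IZR, <- INR_IZR_INZ; ring).
  apply ee_add_IZR.
Qed.

Lemma Cmod2_ee_minus_1 t : Cmod (ee t - 1) ^ 2 = 2 - 2 * cos (2 * PI * t).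
Proof.
  rewrite Cmod2_alt. unfold ee, e_re, e_im, Re, Im. simpl.
  assert (H := sin2_cos2 (2 * PI * t)). unfold Rsqr in H. nra.
Qed.

Lemma ee_far_from_1 eta t : 0 < eta -> eta <= t <= 1 - eta ->
  2 - 2 * cos (2 * PI * eta) <= Cmod (ee t - 1) ^ 2.
Proof.
  intros He Ht. rewrite Cmod2_ee_minus_1. assert (HP := PI_RGT_0).
  assert (cos (2 * PI * t) <= cos (2 * PI * eta)); [|lra].
  destruct (Rle_lt_dec t (1 / 2)) as [H|H].
  - apply cos_decr_1; nra.
  - replace (cos (2 * PI * t)) with (cos (2 * PI * (1 - t))).
    + apply cos_decr_1; nra.
    + rewrite <- (cos_neg (2 * PI * t)), <- (cos_period (- (2 * PI * t)) 1). f_equal. simpl. ring.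
Qed.

Lemma grid_count_interval u v m : 0 <= u ->
  Rmin (INR m) v - u - 1 <=
  grid_count (fun l => if Rle_dec u (INR l) then if Rle_dec (INR l) v then true else false else false) m.
Proof.
  intros Hu. induction m as [|m IH].
  - unfold grid_count. simpl. assert (H := Rmin_l 0 v). lra.
  - set (sel := fun l : nat => _) in *.
    assert (Hpos : 0 <= grid_count sel m)
      by (apply rs_ge0; intros i _; destruct (sel i); lra).
    change (grid_count sel (S m)) with (grid_count sel m + if sel m then 1 else 0).
    rewrite S_INR. unfold sel at 2.
    assert (H1 := Rmin_l (INR m + 1) v). assert (H2 := Rmin_r (INR m + 1) v).
    destruct (Rle_dec u (INR m)) as [Ha|Ha]; [|lra].
    destruct (Rle_dec (INR m) v) as [Hb|Hb].
    + rewrite (Rmin_left (INR m) v) in IH by assumption. lra.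
    + rewrite (Rmin_right (INR m) v) in IH by lra. lra.
Qed.

Lemma grid_count_le sel m : grid_count sel m <= INR m.
Proof.
  rewrite <- (Rmult_1_r (INR m)). apply rs_le_const. intros i _. destruct (sel i); lra.
Qed.

(** Selects the grid points $l/m$ in the shrunken interval $[a+\eta,b-\eta]$. *)
Definition interval_sel (a b eta : R) (m l : nat) : bool :=
  if Rle_dec (INR m * (a + eta)) (INR l) then
    if Rle_dec (INR l) (INR m * (b - eta)) then true else false else false.

Lemma interval_sel_mean a b eta m : (0 < m)%nat -> 0 <= a -> b <= 1 -> 0 < eta ->
  b - a - (2 * eta + / INR m) <= grid_count (interval_sel a b eta m) m / INR m.
Proof.
  intros Hm Ha Hb He. assert (Hm' : 0 < INR m) by now apply lt_0_INR.
  assert (H := grid_count_interval (INR m * (a + eta)) (INR m * (b - eta)) m ltac:(nra)).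
  rewrite Rmin_right in H by nra.
  apply Rmult_le_reg_r with (INR m); [assumption|].
  replace (_ / INR m * INR m) with (grid_count (interval_sel a b eta m) m) by (field; lra).
  eapply Rle_trans; [|exact H]. right. field. lra.
Qed.

(** Selected grid points keep distance $\eta$ from $x$ on the circle, also across the endpoint
    $0\equiv1$ because $[a,b]\subset[0,1]$. *)
Lemma fejer_interval_outside a b eta m x : (0 < m)%nat -> 0 <= a -> b <= 1 -> 0 < eta -> eta <= / 4 ->
  0 <= x < 1 -> ~ (a < x < b) ->
  fejer_sum (interval_sel a b eta m) m x <= 4 / (INR m * (2 - 2 * cos (2 * PI * eta))).
Proof.
  intros Hm Ha Hb He He4 Hx Hout. assert (HP := PI_RGT_0).
  assert (Hm' : 0 < INR m) by now apply lt_0_INR.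
  apply fejer_sum_small; [assumption| |].
  - assert (cos (2 * PI * eta) < cos 0); [apply cos_decreasing_1; nra|]. rewrite cos_0 in *. lra.
  - intros l Hl Hsel. unfold interval_sel in Hsel.
    destruct (Rle_dec _ _) as [H1|]; [|discriminate]. destruct (Rle_dec _ _) as [H2|]; [|discriminate].
    set (t := INR l / INR m). assert (El : INR l = INR m * t) by (unfold t; field; lra).
    rewrite El in H1, H2. apply Rmult_le_reg_l in H1, H2; try assumption.
    destruct (Rle_lt_dec x a) as [H|H].
    + replace (x - t) with (- (t - x)) by ring. rewrite ee_opp.
      replace (Cconj (ee (t - x)) - 1)%C with (Cconj (ee (t - x) - 1)).
      * rewrite Cmod_conj. apply ee_far_from_1; lra.
      * rewrite Cminus_conj. f_equal. unfold Cconj, RtoC; simpl. now rewrite Ropp_0.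
    + assert (b <= x) by (apply Rnot_lt_le; intros H'; apply Hout; lra).
      apply ee_far_from_1; lra.
Qed.

Lemma count_upto_rs P N : INR (count_upto P N) = rs (fun i => if P (S i) then 1 else 0) N.
Proof.
  induction N as [|N IH]; simpl; [reflexivity|]. rewrite plus_INR, IH.
  now destruct (P (S N)).
Qed.

Lemma frac_part_decomp x : x = frac_part x + IZR (Int_part x).
Proof. unfold frac_part. ring. Qed.

Lemma in_open_box_true a b c d x y : in_open_box a b c d x y = true <-> a < x < b /\ c < y < d.
Proof.
  unfold in_open_box.
  destruct (Rlt_dec a x), (Rlt_dec x b), (Rlt_dec c y), (Rlt_dec y d);
    split; intros H; try discriminate; try reflexivity; try tauto; intuition.
Qed.

(** * Densities of boxes *)

Section Weyl.
Context (x y : nat -> R)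
  (Hxy : forall m1 m2 : Z, ~ (m1 = 0%Z /\ m2 = 0%Z) ->
     avg_tends_to_0 (fun n => IZR m1 * x n + IZR m2 * y n)).

Let boxcount (a b c d : R) (N : nat) : R :=
  INR (count_upto (fun n => in_open_box a b c d (frac_part (x n)) (frac_part (y n))) N).

Lemma box_lower_density a b c d eps : 0 <= a -> a <= b -> b <= 1 -> 0 <= c -> c <= d -> d <= 1 ->
  0 < eps -> exists N0, forall N, (N0 <= N)%nat ->
    ((b - a) * (d - c) - eps) * INR N <= boxcount a b c d N.
Proof.
  intros Ha Hab Hb Hc Hcd Hd He.
  (* The budget: shrinking and grid cost $2(2\eta+1/m)\le\varepsilon/2$, leakage outside the box
     $\varepsilon/4$, convergence of the mean $\varepsilon/4$. The bound $1/4$ serves the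
     monotonicity of the cosine. *)
  set (eta := Rmin (/ 4) (eps / 16)).
  assert (Heta : 0 < eta) by (apply Rmin_glb_lt; lra).
  assert (Heta1 : eta <= / 4) by apply Rmin_l. assert (Heta2 : eta <= eps / 16) by apply Rmin_r.
  assert (HP := PI_RGT_0).
  set (e2 := 2 - 2 * cos (2 * PI * eta)).
  assert (He2 : 0 < e2).
  { assert (cos (2 * PI * eta) < cos 0); [apply cos_decreasing_1; nra|]. rewrite cos_0 in *.
    unfold e2. lra. }
  (* The first summand makes $1/m\le\varepsilon/8$, the second makes the leakage [kap] at most
     $\varepsilon/4$. *)
  destruct (INR_unbounded (8 / eps + 16 / (eps * e2))) as [m Hm].
  assert (Hp1 : 0 < 8 / eps) by (apply Rdiv_lt_0_compat; lra).
  assert (Hp2 : 0 < 16 / (eps * e2)) by (apply Rdiv_lt_0_compat; nra).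
  assert (Hm' : 0 < INR m) by lra.
  assert (Hm0 : (0 < m)%nat) by (apply INR_lt; simpl; lra).
  assert (Hinv : / INR m <= eps / 8).
  { replace (eps / 8) with (/ (8 / eps)) by (field; lra). apply Rinv_le_contravar; lra. }
  set (kap := 4 / (INR m * e2)).
  assert (Hkap : 0 <= kap <= eps / 4).
  { split; [left; apply Rdiv_lt_0_compat; nra|].
    unfold kap. apply Rmult_le_reg_r with (INR m * e2); [nra|].
    replace (4 / (INR m * e2) * (INR m * e2)) with 4 by (field; lra).
    assert (16 / (eps * e2) * (eps * e2) <= INR m * (eps * e2)) by (apply Rmult_le_compat_r; nra).
    replace (16 / (eps * e2) * (eps * e2)) with 16 in * by (field; lra). nra. }
  set (TI := fejer_sum (interval_sel a b eta m) m). set (TJ := fejer_sum (interval_sel c d eta m) m).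
  set (mI := grid_count (interval_sel a b eta m) m / INR m).
  set (mJ := grid_count (interval_sel c d eta m) m / INR m).
  destruct (trig_mult_mean x y _ _ _ _ Hxy (fejer_sum_trig (interval_sel a b eta m) m Hm0)
              (fejer_sum_trig (interval_sel c d eta m) m Hm0) (eps / 4)) as [N0 HN0]; [lra|].
  exists N0. intros N HN. specialize (HN0 N HN). fold TI TJ mI mJ in HN0.
  rewrite (csum_ext _ (fun i => RtoC (TI (x (S i)) * TJ (y (S i))))) in HN0
    by (intros; now rewrite RtoC_mult).
  rewrite csum_RtoC, <- !RtoC_mult, <- RtoC_minus, Cmod_R in HN0.
  set (Sm := rs _ N) in HN0.
  rewrite <- Rabs_Ropp in HN0. apply (Rle_trans _ _ _ (Rle_abs _)) in HN0.
  assert (HmI : 0 <= mI <= 1).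
  { assert (H := grid_count_le (interval_sel a b eta m) m). split.
    - apply Rmult_le_pos; [|left; now apply Rinv_0_lt_compat]. apply rs_ge0. intros i _.
      destruct (interval_sel _ _ _ _ i); lra.
    - unfold mI. apply Rmult_le_reg_r with (INR m); [assumption|].
      replace (_ / INR m * INR m) with (grid_count (interval_sel a b eta m) m) by (field; lra). lra. }
  assert (HmJ : 0 <= mJ).
  { apply Rmult_le_pos; [|left; now apply Rinv_0_lt_compat]. apply rs_ge0. intros i _.
    destruct (interval_sel _ _ _ _ i); lra. }
  assert (HI := interval_sel_mean a b eta m Hm0 Ha Hb Heta). fold mI in HI.
  assert (HJ := interval_sel_mean c d eta m Hm0 Hc Hd Heta). fold mJ in HJ.
  assert (Hprod : (b - a) * (d - c) - 2 * (2 * eta + / INR m) <= mI * mJ).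
  { set (s := 2 * eta + / INR m) in *.
    assert (0 <= s) by (assert (0 < / INR m) by (now apply Rinv_0_lt_compat); unfold s; lra).
    assert ((b - a) * (d - c) <= (mI + s) * (d - c)) by (apply Rmult_le_compat_r; lra).
    assert (mI * (d - c) <= mI * (mJ + s)) by (apply Rmult_le_compat_l; lra).
    assert (s * (d - c) <= s * 1) by (apply Rmult_le_compat_l; lra).
    nra. }
  (* Outside the box one coordinate is outside its interval, so one factor is at most [kap] while
     the other is at most 1. *)
  assert (Hcount : Sm - INR N * kap <= boxcount a b c d N).
  { unfold boxcount. rewrite count_upto_rs. unfold Sm.
    replace (INR N * kap) with (rs (fun _ => kap) N) by apply rs_const.
    apply Rplus_le_reg_r with (rs (fun _ => kap) N). rewrite <- rs_plus.
    replace (_ - _ + _) with (rs (fun i => TI (x (S i)) * TJ (y (S i))) N) by ring.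
    apply rs_le. intros i _.
    assert (BI := fejer_sum_bounds (interval_sel a b eta m) m (x (S i)) Hm0).
    assert (BJ := fejer_sum_bounds (interval_sel c d eta m) m (y (S i)) Hm0).
    fold TI in BI. fold TJ in BJ.
    destruct (in_open_box _ _ _ _ _ _) eqn:Ebox; [nra|].
    assert (Hout : ~ (a < frac_part (x (S i)) < b /\ c < frac_part (y (S i)) < d))
      by (rewrite <- in_open_box_true, Ebox; discriminate).
    assert (Fx := base_fp (x (S i))). assert (Fy := base_fp (y (S i))).
    destruct (classic (a < frac_part (x (S i)) < b)) as [Hin|Hin].
    - assert (TJ (y (S i)) <= kap); [|nra].
      unfold TJ. rewrite (frac_part_decomp (y (S i))), fejer_sum_add_IZR.
      apply fejer_interval_outside; try assumption; try lra; tauto.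
    - assert (TI (x (S i)) <= kap); [|nra].
      unfold TI. rewrite (frac_part_decomp (x (S i))), fejer_sum_add_IZR.
      apply fejer_interval_outside; try assumption; lra. }
  assert (HN' : 0 <= INR N) by apply pos_INR.
  nra.
Qed.

(** The box and the four others are disjoint, so their counts add up to at most $N$, and the areas
    of the four sum to $1-(b-a)(d-c)$. Points on the separating lines are counted by none, which
    respects the inequality. *)
Lemma box_upper_density a b c d eps : 0 <= a -> a <= b -> b <= 1 -> 0 <= c -> c <= d -> d <= 1 ->
  0 < eps -> exists N0, forall N, (N0 <= N)%nat ->
    boxcount a b c d N <= ((b - a) * (d - c) + eps) * INR N.
Proof.
  intros Ha Hab Hb Hc Hcd Hd He.
  destruct (box_lower_density 0 a 0 1 (eps / 4)) as [N1 H1]; try lra.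
  destruct (box_lower_density b 1 0 1 (eps / 4)) as [N2 H2]; try lra.
  destruct (box_lower_density a b 0 c (eps / 4)) as [N3 H3]; try lra.
  destruct (box_lower_density a b d 1 (eps / 4)) as [N4 H4]; try lra.
  exists (N1 + N2 + N3 + N4)%nat. intros N HN.
  specialize (H1 N ltac:(lia)). specialize (H2 N ltac:(lia)).
  specialize (H3 N ltac:(lia)). specialize (H4 N ltac:(lia)).
  assert (Hs : boxcount a b c d N + (boxcount 0 a 0 1 N + (boxcount b 1 0 1 N +
      (boxcount a b 0 c N + boxcount a b d 1 N))) <= INR N * 1).
  { unfold boxcount. rewrite !count_upto_rs, <- !rs_plus. apply rs_le_const. intros i _.
    destruct (in_open_box a b c d _ _) eqn:E0; [apply in_open_box_true in E0|];
    (destruct (in_open_box 0 a 0 1 _ _) eqn:E1; [apply in_open_box_true in E1|]);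
    (destruct (in_open_box b 1 0 1 _ _) eqn:E2; [apply in_open_box_true in E2|]);
    (destruct (in_open_box a b 0 c _ _) eqn:E3; [apply in_open_box_true in E3|]);
    (destruct (in_open_box a b d 1 _ _) eqn:E4; [apply in_open_box_true in E4|]);
    lra. }
  nra.
Qed.

Lemma weyl_criterion : unif_distr_mod1_2 x y.
Proof.
  intros a b c d Ha Hab Hb Hc Hcd Hd eps Heps.
  destruct (box_lower_density a b c d (eps / 2)) as [N1 H1]; try lra.
  destruct (box_upper_density a b c d (eps / 2)) as [N2 H2]; try lra.
  exists (S (N1 + N2)). intros N HN.
  specialize (H1 N ltac:(lia)). specialize (H2 N ltac:(lia)). unfold boxcount in *.
  assert (HN' : 0 < INR N) by (apply lt_0_INR; lia).
  unfold Rdist. set (k := INR (count_upto _ N)) in *.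
  assert (E : k = k / INR N * INR N) by (field; lra).
  rewrite E in H1, H2. apply Rmult_le_reg_r in H1, H2; try assumption.
  apply Rabs_def1; lra.
Qed.
End Weyl.

(** * Assembly *)

Lemma poly2_combination d p1 p2 r1 r2 x y :
  poly2 d (fun i j => r1 * p1 i j + r2 * p2 i j) x y = r1 * poly2 d p1 x y + r2 * poly2 d p2 x y.
Proof.
  rewrite !poly2_rs, <- !rs_scal, <- rs_plus. apply rs_ext. intros i _.
  rewrite <- !rs_scal, <- rs_plus. apply rs_ext. intros j _. ring.
Qed.

Lemma avg_tends_to_0_ext f g : (forall n, f n = g n) -> avg_tends_to_0 f -> avg_tends_to_0 g.
Proof.
  intros E H eta Heta. destruct (H eta Heta) as [L HL]. exists L. intros M N HMN HN.
  specialize (HL M N HMN HN). rewrite exp_avg_mod_csum in * by assumption.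
  rewrite <- (csum_ext (fun i => ee (f (M + S i)%nat))) by (intros; now rewrite E). exact HL.
Qed.

Theorem mainTheorem7 (b : nat) (D : list nat) (k : nat -> nat)
  (Hb : (3 <= b)%nat)
  (HDnd : NoDup D)
  (HDsub : forall x, In x D -> (x < b)%nat)
  (HD0 : In 0%nat D)
  (HDcard : (2 <= length D)%nat /\ (length D < b)%nat)
  (* k_1 < k_2 < ... is the increasing enumeration of C_{b,D} *)
  (Hkinc : forall n, (1 <= n)%nat -> (k n < k (S n))%nat)
  (Hkrange : forall x, inC b D x <-> exists n, (1 <= n)%nat /\ k n = x) :
  (forall (d : nat) (c : nat -> nat -> R),
     has_irrational_nonconst_coef d c ->
     avg_tends_to_0 (fun n => poly2 d c (INR (k n)) (INR (sdig b (k n)))))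
  /\
  (forall (d : nat) (p1 p2 : nat -> nat -> R),
     (forall m1 m2 : Z, ~ (m1 = 0%Z /\ m2 = 0%Z) ->
        has_irrational_nonconst_coef d
          (fun i j => IZR m1 * p1 i j + IZR m2 * p2 i j)) ->
     unif_distr_mod1_2
       (fun n => poly2 d p1 (INR (k n)) (INR (sdig b (k n))))
       (fun n => poly2 d p2 (INR (k n)) (INR (sdig b (k n))))
     /\
     (forall m1 m2 : Z, ~ (m1 = 0%Z /\ m2 = 0%Z) ->
        avg_tends_to_0 (fun n =>
          IZR m1 * poly2 d p1 (INR (k n)) (INR (sdig b (k n))) +
          IZR m2 * poly2 d p2 (INR (k n)) (INR (sdig b (k n)))))).
Proof.
  destruct HDcard as [HD2 _].
  destruct (sorted_digits D b HDnd HDsub) as [delta [Hinc HDdelta]].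
  set (B := length D) in *.
  assert (Hlt : forall i, (i < B)%nat -> (delta i < b)%nat)
    by (intros i Hi; apply HDsub, HDdelta; eauto).
  (* Since 0 belongs to $D$ and [delta] is increasing, 0 must be its first value. *)
  assert (Hd0 : delta 0%nat = 0%nat).
  { destruct (proj1 (HDdelta 0%nat) HD0) as [[|i] [Hi Ei]]; [assumption|].
    assert (delta 0%nat < delta (S i))%nat by (apply Hinc; lia). lia. }
  assert (Hd1 : (1 <= delta 1)%nat)
    by (assert (delta 0 < delta 1)%nat by (apply Hinc; lia); lia).
  assert (Hb2 : (2 <= b)%nat) by lia.
  assert (Hk : forall n, k (S n) = digmap b B delta n).
  { apply enumeration_digmap; try assumption. intros x. rewrite <- Hkrange. symmetry.
    now apply inC_digmap. }
  assert (Havg : forall d c, has_irrational_nonconst_coef d c ->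
    avg_tends_to_0 (fun n => poly2 d c (INR (k n)) (INR (sdig b (k n))))).
  { intros d c. apply (digmap_poly2_avg b B delta Hb2 HD2 Hd0 Hd1 k d c Hk).
    intros n. now apply sdig_digmap. }
  assert (Havg2 : forall d p1 p2,
     (forall m1 m2 : Z, ~ (m1 = 0%Z /\ m2 = 0%Z) ->
        has_irrational_nonconst_coef d (fun i j => IZR m1 * p1 i j + IZR m2 * p2 i j)) ->
     forall m1 m2 : Z, ~ (m1 = 0%Z /\ m2 = 0%Z) ->
        avg_tends_to_0 (fun n =>
          IZR m1 * poly2 d p1 (INR (k n)) (INR (sdig b (k n))) +
          IZR m2 * poly2 d p2 (INR (k n)) (INR (sdig b (k n))))).
  { intros d p1 p2 Hp m1 m2 Hm. eapply avg_tends_to_0_ext; [|exact (Havg d _ (Hp m1 m2 Hm))].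
    intros n. apply poly2_combination. }
  split; [exact Havg|]. intros d p1 p2 Hp. split; [|exact (Havg2 d p1 p2 Hp)].
  apply weyl_criterion. exact (Havg2 d p1 p2 Hp).
Qed.
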